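(* Assume that $\mathbf{char}(q)=\ell\ (\ge3)$ is odd (resp. even). Then the quantum restricted differential Hopf algebra $\mathfrak D_q(m|n,\mathbf 1)$, i.e. the quotient of the Hopf algebra $\mathfrak D_q(m|n)$ by the Hopf ideal $\mathcal I$ generated by $\sigma_i^\ell-1$ (resp. $\sigma_i^{2\ell}-1$) and $\Theta(\epsilon_i)^\ell-1$ (resp. $\Theta(\epsilon_i)^{2\ell}-1$) for $i\in I$, and $\partial_i^\ell$ for $i\in I_0$, is a finite-dimensional pointed Hopf algebra associated with the bicharacter $\theta$ defined over $\mathbb Z_\ell^m\times\mathbb Z_2^n$ (resp. $\mathbb Z_{2\ell}^m\times\mathbb Z_2^n$).
   Context: $\Bbbk$ is an algebraically closed field of characteristic zero, $q\in\Bbbk^\times$, $q\ne1$; $\mathbf{char}(q)$ is the least positive integer $\ell$ with $[\ell]=\frac{q^\ell-q^{-\ell}}{q-q^{-1}}=0$, and $0$ if none exists. $m,n\ge0$ are integers, $I_0=\{1,\dots,m\}$, $I_1=\{m+1,\dots,m+n\}$, $I=I_0\cup I_1$, $J=\{1,\dots,m+n-1\}$; $\mathbb Z_k=\mathbb Z/k\mathbb Z$. For integer tuples $a,b$ of length $m+n$ put $a*b=\sum_{i>j}a_ib_j$; $\epsilon_i$ are the standard basis vectors. An element $\langle\alpha,\mu\rangle\in\mathbb Z^m\times\mathbb Z_2^n$ is regarded as an $(m+n)$-tuple, written $\alpha+\mu$, with $\alpha$ in the first $m$ places and $\mu$ (entries $0,1$) in the last $n$ places. The bicharacter $\theta$ is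 given on $\mathbb Z^m\times\mathbb Z_2^n$, with values in $\Bbbk^*$, by $$\theta(\langle\alpha,\mu\rangle,\langle\beta,\nu\rangle)=(-1)^{\mu*\nu-\nu*\mu}q^{(\alpha+\mu)*\beta-(\beta+\nu)*\alpha+\mu*\nu-\nu*\mu},$$ and in the statement it is considered over $\mathbb Z_\ell^m\times\mathbb Z_2^n$ (resp. $\mathbb Z_{2\ell}^m\times\mathbb Z_2^n$). On basis vectors, $\theta(\epsilon_i,\epsilon_j)=(-q)^{\epsilon_i*\epsilon_j-\epsilon_j*\epsilon_i}$ if $i,j\in I_1$, and $\theta(\epsilon_i,\epsilon_j)=q^{\epsilon_i*\epsilon_j-\epsilon_j*\epsilon_i}$ otherwise. Let $|\partial_i|=\bar0$ for $i\in I_0$ and $|\partial_i|=\bar1$ for $i\in I_1$. $\mathfrak D_q(m|n)$ is the associative $\Bbbk$-algebra generated by $\partial_i$, $\Theta(\pm\epsilon_i)$, $\sigma_i^{\pm1}$ $(i\in I)$, $\tau_j$ $(j\in I_1)$, with $\tau:=\prod_{j\in I_1}\tau_j$, associated to the bicharacter $\theta$ on $\mathbb Z^m\times\mathbb Z_2^n$, subject to (whenever indices are in range): $\sigma_i\sigma_i^{-1}=1=\sigma_i^{-1}\sigma_i$, $\sigma_i\sigma_j=\sigma_j\sigma_i$ $(i,j\in I)$; $\tau^2=1=\tau_i^2$, $\tau_i\tau_j=\tau_j\tau_i$ $(i,j\in I_1)$, $\sigma_i\tau_j=\tau_j\sigma_i$ $(i\in I,j\in I_1)$; $\Theta(\epsilon_i)\Theta(-\epsilon_i)=1=\Theta(-\epsilon_i)\Theta(\epsilon_i)$,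 $\Theta(\epsilon_i)\Theta(\epsilon_j)=\Theta(\epsilon_i+\epsilon_j)=\Theta(\epsilon_j)\Theta(\epsilon_i)$ (so that $\Theta(a)$ is the corresponding monomial for $a\in\mathbb Z^{m+n}$); $\sigma_j\Theta(\epsilon_i)=\Theta(\epsilon_i)\sigma_j$ $(i,j\in I)$, $\tau_j\Theta(\epsilon_i)=\Theta(\epsilon_i)\tau_j$ $(i\in I,j\in I_1)$; $\Theta(-\epsilon_m+\epsilon_{m+1})=\tau\sigma_m\sigma_{m+1}$, $\Theta(-\epsilon_i+\epsilon_{i+1})=\sigma_i\sigma_{i+1}$ $(m\ne i\in J)$; $\Theta(\epsilon_j)\partial_i\Theta(\epsilon_j)^{-1}=\theta(\epsilon_i,\epsilon_j)\partial_i$, $\sigma_j\partial_i\sigma_j^{-1}=(-1)^{\delta_{\bar1,|\partial_i|}\delta_{ij}}q^{-\delta_{ij}}\partial_i$ $(i,j\in I)$; $\tau_j\partial_i=(-1)^{\delta_{ij}}\partial_i\tau_j$ $(i\in I,j\in I_1)$; $\partial_i\partial_j=\theta(\epsilon_i,\epsilon_j)\partial_j\partial_i$ $(i,j\in I)$; $\partial_j^2=0$ $(j\in I_1)$. It is a Hopf algebra in which all $\sigma_i^{\pm1}$, $\Theta(\pm\epsilon_i)$, $\tau_j$ are group-like, $\Delta(\partial_i)=\partial_i\otimes\sigma_i^{-1}+\Theta(-\epsilon_i)\sigma_i\otimes\partial_i$ $(i\in I_0)$, $\Delta(\partial_j)=\partial_j\otimes1+\Theta(-\epsilon_j)\tau_j\otimes\partial_j$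 $(j\in I_1)$, $\epsilon(\partial_i)=0$ $(i\in I)$, $S(\partial_i)=-q\Theta(\epsilon_i)\partial_i$ $(i\in I_0)$, $S(\partial_j)=-\Theta(\epsilon_j)\tau_j\partial_j$ $(j\in I_1)$. A Hopf algebra is pointed if all its simple subcoalgebras are one-dimensional.
   Formalization: For odd ℓ, that θ descends to Z_ℓ^m×Z_2^n is stated only if q^ℓ=1 (char(q)=ℓ allows q^ℓ=-1, where it fails, e.g. ℓ=3, q a primitive 6th root of unity, m≥2); θ is given by the tuple formula on representatives, without claiming bimultiplicativity on Z_2^n, which fails. *)

(* Defs.v *)
From HB Require Import structures.
From mathcomp Require Import all_boot all_order all_algebra.
From mathcomp Require Import boolp classical_sets.
From mathcomp Require Import finmap monalg.

Set Implicit Arguments.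
Unset Strict Implicit.
Unset Printing Implicit Defensive.

Import GRing.Theory.

Local Open Scope quotient_scope.
Local Open Scope classical_set_scope.
Local Open Scope ring_scope.

Section Span.
Variables (R : pzRingType) (V : lmodType R).

Definition is_subspace (W : set V) : Prop :=
  W 0 /\ forall (c : R) (u v : V), W u -> W v -> W (c *: u + v).

Definition linspan (S : set V) : set V := smallest is_subspace S.

Lemma linspan_subspace S : is_subspace (linspan S).
Proof.
split; first by move=> W [[]].
by move=> c u v Wu Wv W WS; apply: WS.1.2; [apply: Wu|apply: Wv].
Qed.

Lemma linspan_ind (S P : set V) : is_subspace P -> S `<=` P -> linspan S `<=` P.
Proof. exact: smallest_sub. Qed.

Lemma linspan_gen (S : set V) : S `<=` linspan S.
Proof. exact: sub_gen_smallest. Qed.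

End Span.

Section LQuotDef.
Variables (R : pzRingType) (V : lmodType R) (S : set V).

Definition span_rel (u v : V) : bool := `[< linspan S (u - v) >].

Fact span_rel_equiv : equiv_class_of span_rel.
Proof.
have [h0 hD] := linspan_subspace S.
split=> [x|x y|y x z]; rewrite /span_rel; first by rewrite subrr; apply/asboolP.
- apply/asboolP/asboolP => h; rewrite -opprB -scaleN1r -[_ *: _]addr0;
    exact: hD.
move=> /asboolP hx /asboolP hy; apply/asboolP.
by rewrite -[x](subrK y) -addrA -[x - y]scale1r; apply: hD.
Qed.

Canonical span_rel_equivRel := EquivRelPack span_rel_equiv.
Canonical span_rel_encModRel := defaultEncModRel span_rel.

(* V / span(S) *)
Definition lquot : Type := {eq_quot span_rel}.

HB.instance Definition _ := Choice.on lquot.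

End LQuotDef.

(* The operations below are locked since unfolding them during unification is
   costly. *)
HB.lock Definition lpi (R : pzRingType) (V : lmodType R) (S : set V) (v : V) :
  lquot S := \pi_({eq_quot (span_rel S)}) v.

HB.lock Definition lrepr (R : pzRingType) (V : lmodType R) (S : set V)
  (x : lquot S) : V := repr (x : {eq_quot (span_rel S)}).

HB.lock Definition lquot_add (R : pzRingType) (V : lmodType R) (S : set V)
  (x y : lquot S) : lquot S := lpi S (lrepr x + lrepr y).

HB.lock Definition lquot_opp (R : pzRingType) (V : lmodType R) (S : set V)
  (x : lquot S) : lquot S := lpi S (- lrepr x).

HB.lock Definition lquot_scale (R : pzRingType) (V : lmodType R) (S : set V)
  (c : R) (x : lquot S) : lquot S := lpi S (c *: lrepr x).

Section LQuot.
Variables (R : pzRingType) (V : lmodType R) (S : set V).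

Local Notation lquot := (lquot S).
Local Notation lpi := (@lpi R V S).
Local Notation lquot_add := (@lquot_add R V S).
Local Notation lquot_opp := (@lquot_opp R V S).
Local Notation lquot_scale := (@lquot_scale R V S).

Lemma lpi_repr (x : lquot) : lpi (lrepr x) = x.
Proof. rewrite lpi.unlock lrepr.unlock; exact: reprK. Qed.

Lemma lpiP u v : lpi u = lpi v <-> linspan S (u - v).
Proof.
rewrite lpi.unlock; split=> [/eqP|h].
  by rewrite eqmodE => /asboolP.
by apply/eqP; rewrite eqmodE; apply/asboolP.
Qed.

Lemma lpi_ind (P : lquot -> Prop) : (forall v, P (lpi v)) -> forall x, P x.
Proof. by move=> h x; rewrite -(lpi_repr x). Qed.

Lemma repr_lpi v : linspan S (lrepr (lpi v) - v).
Proof. by apply/lpiP; rewrite lpi_repr. Qed.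

Fact lpi_add u v : lquot_add (lpi u) (lpi v) = lpi (u + v).
Proof.
rewrite lquot_add.unlock; apply/lpiP.
rewrite opprD addrACA -[X in X + _]scale1r.
by apply: (linspan_subspace S).2; exact: repr_lpi.
Qed.

Fact lpi_scale c v : lquot_scale c (lpi v) = lpi (c *: v).
Proof.
rewrite lquot_scale.unlock; apply/lpiP; rewrite -scalerBr -[X in linspan S X]addr0.
have [h0 h] := linspan_subspace S.
by apply: h => //; exact: repr_lpi.
Qed.

Fact lpi_opp v : lquot_opp (lpi v) = lpi (- v).
Proof.
rewrite -[in RHS]scaleN1r -lpi_scale.
by rewrite lquot_opp.unlock lquot_scale.unlock scaleN1r.
Qed.

Fact lquot_addA : associative lquot_add.
Proof.
move=> x y z; elim/lpi_ind: x => x; elim/lpi_ind: y => y; elim/lpi_ind: z => z.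
by rewrite !lpi_add addrA.
Qed.

Fact lquot_addC : commutative lquot_add.
Proof.
move=> x y; elim/lpi_ind: x => x; elim/lpi_ind: y => y.
by rewrite !lpi_add addrC.
Qed.

Fact lquot_add0 : left_id (lpi 0) lquot_add.
Proof. by elim/lpi_ind=> x; rewrite lpi_add add0r. Qed.

Fact lquot_addN : left_inverse (lpi 0) lquot_opp lquot_add.
Proof. by elim/lpi_ind=> x; rewrite lpi_opp lpi_add addNr. Qed.

HB.instance Definition _ := GRing.isZmodule.Build lquot
  lquot_addA lquot_addC lquot_add0 lquot_addN.

Lemma lpiD u v : lpi (u + v) = lpi u + lpi v.
Proof. by rewrite -lpi_add. Qed.

Lemma lpi_zmod : zmod_morphism lpi.
Proof. by move=> u v; rewrite lpiD -lpi_opp. Qed.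

HB.instance Definition _ := GRing.isZmodMorphism.Build V lquot lpi lpi_zmod.

Fact lquot_scaleA a b v : lquot_scale a (lquot_scale b v) = lquot_scale (a * b) v.
Proof. by elim/lpi_ind: v => v; rewrite !lpi_scale scalerA. Qed.

Fact lquot_scale1 : left_id 1 lquot_scale.
Proof. by elim/lpi_ind=> v; rewrite lpi_scale scale1r. Qed.

Fact lquot_scaleDr : right_distributive lquot_scale +%R.
Proof.
move=> c x y; elim/lpi_ind: x => x; elim/lpi_ind: y => y.
by rewrite -lpiD !lpi_scale scalerDr lpiD.
Qed.

Fact lquot_scaleDl v : {morph lquot_scale^~ v : a b / a + b}.
Proof. by elim/lpi_ind: v => v a b /=; rewrite !lpi_scale scalerDl lpiD. Qed.

HB.instance Definition _ := GRing.Zmodule_isLmodule.Build R lquot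
  lquot_scaleA lquot_scale1 lquot_scaleDr lquot_scaleDl.

Fact lpi_scalable : scalable lpi.
Proof. by move=> c v /=; rewrite -lpi_scale. Qed.

HB.instance Definition _ := GRing.isScalable.Build R V lquot *:%R lpi lpi_scalable.

Definition lquot_lift (T : Type) (f : V -> T) (x : lquot) : T := f (lrepr x).

Lemma lquot_liftE (W : lmodType R) (f : V -> W) (v : V) :
  linear f -> (forall s, S s -> f s = 0) -> lquot_lift f (lpi v) = f v.
Proof.
move=> fL fS.
have fB u w : f (u - w) = f u - f w by rewrite addrC -scaleN1r fL scaleN1r addrC.
have f0 : f 0 = 0 by rewrite -(subrr 0) fB subrr.
apply/eqP; rewrite -subr_eq0 -fB; apply/eqP.
have Psub : is_subspace [set x | f x = 0].
  by split=> //= c u w fu fw; rewrite fL fu fw scaler0 addr0.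
exact: (linspan_ind Psub fS (repr_lpi v)).
Qed.

End LQuot.

Section Ideal.
Variables (R : comNzRingType) (A : algType R).

Definition ideal_gens (S : set A) : set A :=
  [set x | exists a s b, S s /\ x = a * s * b].

(* The two-sided ideal generated by S. *)
Definition ideal (S : set A) : set A := linspan (ideal_gens S).

Lemma ideal_mull S a x : ideal S x -> ideal S (a * x).
Proof.
move=> Sx; have [h0 hL] := linspan_subspace (ideal_gens S).
apply: (@linspan_ind _ _ (ideal_gens S) [set x | ideal S (a * x)]) Sx.
  split=> [|c u v hu hv] /=; first by rewrite mulr0.
  by rewrite mulrDr -scalerAr; apply: hL.
move=> _ [b [s [c [Ss ->]]]]; apply: linspan_gen.
by exists (a * b), s, c; rewrite !mulrA.
Qed.

Lemma ideal_mulr S a x : ideal S x -> ideal S (x * a).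
Proof.
move=> Sx; have [h0 hL] := linspan_subspace (ideal_gens S).
apply: (@linspan_ind _ _ (ideal_gens S) [set x | ideal S (x * a)]) Sx.
  split=> [|c u v hu hv] /=; first by rewrite mul0r.
  by rewrite mulrDl -scalerAl; apply: hL.
move=> _ [b [s [c [Ss ->]]]]; apply: linspan_gen.
by exists b, s, (c * a); rewrite !mulrA.
Qed.

Lemma ideal_gen S : S `<=` ideal S.
Proof. by move=> s Ss; apply: linspan_gen; exists 1, s, 1; rewrite mul1r mulr1. Qed.

End Ideal.

(* A / (S); the proof that (S) is proper is needed since the zero ring is not
   an [algType]. *)
Definition aquot (R : comNzRingType) (A : algType R) (S : set A)
  of ~ ideal S 1 : Type := lquot (ideal_gens S).

Definition api (R : comNzRingType) (A : algType R) (S : set A)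
  (S1 : ~ ideal S 1) : A -> aquot S1 := @lpi _ _ (ideal_gens S).

HB.lock Definition aquot_mul (R : comNzRingType) (A : algType R) (S : set A)
  (S1 : ~ ideal S 1) (x y : aquot S1) : aquot S1 :=
  api S1 (lrepr (x : lquot _) * lrepr (y : lquot _)).

Section AQuot.
Variables (R : comNzRingType) (A : algType R) (S : set A) (S1 : ~ ideal S 1).
Local Notation Q := (aquot S1).
Local Notation api := (@api R A S S1).
Local Notation aquot_mul := (@aquot_mul R A S S1).

HB.instance Definition _ := GRing.Lmodule.on Q.

HB.instance Definition _ := GRing.Linear.copy api (@lpi _ _ (ideal_gens S)).

Lemma apiP (u v : A) : api u = api v <-> ideal S (u - v).
Proof. exact: lpiP. Qed.

Lemma api_repr (x : Q) : api (lrepr (x : lquot _)) = x.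
Proof. exact: lpi_repr. Qed.

Lemma api_ind (P : Q -> Prop) : (forall a, P (api a)) -> forall x, P x.
Proof. exact: lpi_ind. Qed.

Lemma api_mul x y : aquot_mul (api x) (api y) = api (x * y).
Proof.
rewrite aquot_mul.unlock; apply/apiP; set x' := lrepr _; set y' := lrepr _.
have -> : x' * y' - x * y = 1 *: ((x' - x) * y') + x * (y' - y).
  by rewrite scale1r mulrBl mulrBr addrA subrK.
have [_ hL] := linspan_subspace (ideal_gens S).
by apply: hL; [apply: ideal_mulr|apply: ideal_mull]; exact: repr_lpi.
Qed.

Fact aquot_mulA : associative aquot_mul.
Proof.
move=> x y z; elim/api_ind: x => x; elim/api_ind: y => y; elim/api_ind: z => z.
by rewrite !api_mul mulrA.
Qed.

Fact aquot_mul1l : left_id (api 1) aquot_mul.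
Proof. by elim/api_ind=> x; rewrite api_mul mul1r. Qed.

Fact aquot_mul1r : right_id (api 1) aquot_mul.
Proof. by elim/api_ind=> x; rewrite api_mul mulr1. Qed.

Fact aquot_mulDl : left_distributive aquot_mul +%R.
Proof.
move=> x y z; elim/api_ind: x => x; elim/api_ind: y => y; elim/api_ind: z => z.
by rewrite -raddfD !api_mul mulrDl raddfD.
Qed.

Fact aquot_mulDr : right_distributive aquot_mul +%R.
Proof.
move=> x y z; elim/api_ind: x => x; elim/api_ind: y => y; elim/api_ind: z => z.
by rewrite -raddfD !api_mul mulrDr raddfD.
Qed.

Fact aquot_1_neq0 : api 1 != 0.
Proof.
by apply/eqP => h; apply: S1; rewrite -[1]subr0; apply/apiP; rewrite raddf0.
Qed.

HB.instance Definition _ := GRing.Zmodule_isNzRing.Build Q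
  aquot_mulA aquot_mul1l aquot_mul1r aquot_mulDl aquot_mulDr aquot_1_neq0.

Fact api_monoid : monoid_morphism api.
Proof. by split=> // x y; rewrite -api_mul. Qed.

HB.instance Definition _ := GRing.isMonoidMorphism.Build A Q api api_monoid.

Lemma apiM x y : api (x * y) = api x * api y.
Proof. exact: rmorphM. Qed.

Lemma apiZ c x : api (c *: x) = c *: api x.
Proof. exact: linearZ. Qed.

Fact aquot_scaleAl (c : R) (x y : Q) : c *: (x * y) = (c *: x) * y.
Proof.
elim/api_ind: x => x; elim/api_ind: y => y.
by rewrite -apiM -!apiZ -apiM scalerAl.
Qed.

HB.instance Definition _ := GRing.Lmodule_isLalgebra.Build R Q aquot_scaleAl.

Fact aquot_scaleAr (c : R) (x y : Q) : c *: (x * y) = x * (c *: y).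
Proof.
elim/api_ind: x => x; elim/api_ind: y => y.
by rewrite -apiM -!apiZ -apiM scalerAr.
Qed.

HB.instance Definition _ := GRing.Lalgebra_isAlgebra.Build R Q aquot_scaleAr.

End AQuot.

Section TensorDef.
Variables (R : comNzRingType) (A B : lmodType R).

Local Notation F := {malg R[(A * B)%type]}.

Inductive tensor_rel : set F :=
| TensorRelL c a a' b :
    tensor_rel (<< (c *: a + a', b) >> - (c *: << (a, b) >> + << (a', b) >>))
| TensorRelR c a b b' :
    tensor_rel (<< (a, c *: b + b') >> - (c *: << (a, b) >> + << (a, b') >>)).

Definition tensor : Type := lquot tensor_rel.

HB.instance Definition _ := GRing.Lmodule.on tensor.

Definition bilinear_fun (V : lmodType R) (f : A -> B -> V) : Prop :=
  (forall b, linear (f^~ b)) /\ (forall a, linear (f a)).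

Definition tlift0 (V : lmodType R) (f : A -> B -> V)
  (g : {malg R[(A * B)%type]}) : V :=
  \sum_(p <- msupp g) g@_p *: f p.1 p.2.

End TensorDef.

HB.lock Definition tens (R : comNzRingType) (A B : lmodType R) (a : A) (b : B) :
  tensor A B := lpi (@tensor_rel R A B) << (a, b) >>.

(* The linear map A (x) B -> V induced by f; only meaningful if f is bilinear,
   see [tliftE]. *)
HB.lock Definition tlift (R : comNzRingType) (A B V : lmodType R)
  (f : A -> B -> V) : tensor A B -> V := lquot_lift (tlift0 f).

Arguments tens {R A B} a b.
Arguments tlift {R A B V} f x.

Section Tensor.
Variables (R : comNzRingType) (A B : lmodType R).

Lemma tensL (c : R) (a a' : A) (b : B) :
  tens (c *: a + a') b = c *: tens a b + tens a' b.
Proof.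
rewrite tens.unlock -linearP; apply/lpiP; apply: linspan_gen.
exact: TensorRelL.
Qed.

Lemma tensR (c : R) (a : A) (b b' : B) :
  tens a (c *: b + b') = c *: tens a b + tens a b'.
Proof.
rewrite tens.unlock -linearP; apply/lpiP; apply: linspan_gen.
exact: TensorRelR.
Qed.

Section Lift.
Variables (V : lmodType R) (f : A -> B -> V).

Lemma tlift0w (d : {fset A * B}) (g : {malg R[(A * B)%type]}) :
  (msupp g `<=` d)%fset ->
  tlift0 f g = \sum_(p <- d) g@_p *: f p.1 p.2.
Proof.
move=> le; rewrite [LHS](big_fset_incl _ le) => //= x xd /mcoeff_outdom ->.
by rewrite scale0r.
Qed.

Lemma tlift0_linear : linear (tlift0 f).
Proof.
move=> c u v.
pose d := (msupp (c *: u + v)%R `|` (msupp u `|` msupp v))%fset.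
rewrite (@tlift0w d) ?fsubsetUl // (@tlift0w d u) ?(@tlift0w d v).
- rewrite scaler_sumr -big_split /=; apply: eq_bigr => p _.
  by rewrite mcoeffD mcoeffZ scalerDl scalerA.
- exact: fsubset_trans (fsubsetUr _ _) (fsubsetUr _ _).
- exact: fsubset_trans (fsubsetUl _ _) (fsubsetUr _ _).
Qed.

Lemma tlift0U p : tlift0 f << p >> = f p.1 p.2.
Proof. by rewrite (tlift0w msuppU_le) big_seq_fset1 mcoeffUU scale1r. Qed.

Hypothesis fL : bilinear_fun f.

Lemma tlift0_rel s : tensor_rel s -> tlift0 f s = 0.
Proof.
have L := tlift0_linear.
have LB u v : tlift0 f (u - v) = tlift0 f u - tlift0 f v.
  by have := L (-1) v u; rewrite !scaleN1r ![- _ + _]addrC.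
case=> [c a a' b|c a b b']; rewrite LB L !tlift0U /=.
  by rewrite fL.1 subrr.
by rewrite fL.2 subrr.
Qed.

Lemma tlift_lpi g : tlift f (lpi (@tensor_rel _ _ _) g) = tlift0 f g.
Proof. rewrite tlift.unlock; exact: (lquot_liftE _ tlift0_linear tlift0_rel). Qed.

Lemma tliftE a b : tlift f (tens a b) = f a b.
Proof. by rewrite tens.unlock tlift_lpi tlift0U. Qed.

Lemma tlift_linear : linear (tlift f).
Proof.
move=> c x y; elim/lpi_ind: x => x; elim/lpi_ind: y => y.
have -> : c *: lpi (@tensor_rel _ _ _) x + lpi (@tensor_rel _ _ _) y =
    lpi (@tensor_rel _ _ _) (c *: x + y).
  by rewrite linearP.
by rewrite !tlift_lpi tlift0_linear.
Qed.

End Lift.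

Lemma tensor_ind (P : tensor A B -> Prop) :
  (forall a b, P (tens a b)) -> (forall c x y, P x -> P y -> P (c *: x + y)) ->
  forall x, P x.
Proof.
move=> Pt PD; elim/lpi_ind => g.
have P0 : P 0.
  by have := PD (-1) _ _ (Pt 0 0) (Pt 0 0); rewrite scaleN1r addNr.
have -> : lpi (@tensor_rel _ _ _) g = \sum_(p <- msupp g) g@_p *: tens p.1 p.2.
  rewrite {1}[g]monalgE raddf_sum; apply: eq_bigr => -[a b] _ /=.
  rewrite tens.unlock -linearZ; congr lpi; apply/malgP => p.
  by rewrite mcoeffZ !mcoeffU mulr_natr.
by elim/big_rec: _ => // p x _ Px; apply: PD.
Qed.

End Tensor.

HB.lock Definition tensor_mul (R : comNzRingType) (A B : algType R)
  (x y : tensor A B) : tensor A B :=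
  tlift (fun a b => tlift (fun a' b' => tens (a * a') (b * b')) y) x.

Section TensorAlgebra.
Variables (R : comNzRingType) (A B : algType R).
Local Notation T := (tensor A B).
Local Notation tensor_mul := (@tensor_mul R A B).

Fact bil_inner a b : bilinear_fun (fun (a' : A) (b' : B) => tens (a * a') (b * b')).
Proof.
split=> [b' c u v|a' c u v]; rewrite mulrDr -scalerAr; first exact: tensL.
exact: tensR.
Qed.

Fact bil_outer (y : T) :
  bilinear_fun (fun a b => tlift (fun a' b' => tens (a * a') (b * b')) y).
Proof.
split=> [b c u v|a c u v]; move: y; apply: tensor_ind.
- move=> a' b'; rewrite !(tliftE (bil_inner _ _)).
  by rewrite mulrDl -scalerAl tensL.
- move=> d x y Hx Hy; rewrite !(tlift_linear (bil_inner _ _)) Hx Hy.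
  by rewrite !scalerDr !scalerA [d * c]mulrC addrACA.
- move=> a' b'; rewrite !(tliftE (bil_inner _ _)).
  by rewrite mulrDl -scalerAl tensR.
- move=> d x y Hx Hy; rewrite !(tlift_linear (bil_inner _ _)) Hx Hy.
  by rewrite !scalerDr !scalerA [d * c]mulrC addrACA.
Qed.

Lemma tensor_mulE a b a' b' :
  tensor_mul (tens a b) (tens a' b') = tens (a * a') (b * b').
Proof. by rewrite tensor_mul.unlock (tliftE (bil_outer _)) (tliftE (bil_inner _ _)). Qed.

Lemma tensor_mul_linl (y : T) : linear (tensor_mul^~ y).
Proof.
move=> c u v; rewrite tensor_mul.unlock; exact: (tlift_linear (bil_outer y)).
Qed.

Lemma tensor_mul_linr (x : T) : linear (tensor_mul x).
Proof.
move=> c u v; move: x; apply: tensor_ind => [a b|d x y Hx Hy].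
  rewrite tensor_mul.unlock !(tliftE (bil_outer _)).
  exact: (tlift_linear (bil_inner _ _)).
by rewrite !tensor_mul_linl Hx Hy !scalerDr !scalerA [d * c]mulrC addrACA.
Qed.

Fact tensor_mulA : associative tensor_mul.
Proof.
move=> x y z; move: x; apply: tensor_ind => [a b|d x x' Hx Hx'];
  last by rewrite !tensor_mul_linl Hx Hx'.
move: y; apply: tensor_ind => [a' b'|d y y' Hy Hy'];
  last by rewrite !(tensor_mul_linl, tensor_mul_linr) Hy Hy'.
move: z; apply: tensor_ind => [a'' b''|d z z' Hz Hz'];
  last by rewrite !tensor_mul_linr Hz Hz'.
by rewrite !tensor_mulE !mulrA.
Qed.

Fact tensor_mul1l : left_id (tens 1 1) tensor_mul.
Proof.
apply: tensor_ind => [a b|d x y Hx Hy]; first by rewrite tensor_mulE !mul1r.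
by rewrite tensor_mul_linr Hx Hy.
Qed.

Fact tensor_mul1r : right_id (tens 1 1) tensor_mul.
Proof.
apply: tensor_ind => [a b|d x y Hx Hy]; first by rewrite tensor_mulE !mulr1.
by rewrite tensor_mul_linl Hx Hy.
Qed.

Fact tensor_mulDl : left_distributive tensor_mul +%R.
Proof. by move=> x y z; have := tensor_mul_linl z 1 x y; rewrite !scale1r. Qed.

Fact tensor_mulDr : right_distributive tensor_mul +%R.
Proof. by move=> x y z; have := tensor_mul_linr x 1 y z; rewrite !scale1r. Qed.

(* Only a [pzRingType]: that tens 1 1 != 0 is not established here. *)
HB.instance Definition _ := GRing.Zmodule_isPzRing.Build T
  tensor_mulA tensor_mul1l tensor_mul1r tensor_mulDl tensor_mulDr.

Lemma tensM a b a' b' : tens a b * tens a' b' = tens (a * a') (b * b') :> T.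
Proof. exact: tensor_mulE. Qed.

End TensorAlgebra.

Section TensorMaps.
Variable R : comNzRingType.

Definition tmap (A B C D : lmodType R) (f : A -> C) (g : B -> D) :
  tensor A B -> tensor C D := tlift (fun a b => tens (f a) (g b)).

Definition tassoc (A B C : lmodType R) :
  tensor (tensor A B) C -> tensor A (tensor B C) :=
  tlift (fun t c => tlift (fun a b => tens a (tens b c)) t).

End TensorMaps.

Section Hopf.
Variable R : comNzRingType.

Record hopf (A : algType R) := Hopf {
  comul : {linear A -> tensor A A};
  counit : {scalar A};
  antipode : {linear A -> A};
  comul_monoid : monoid_morphism comul;
  counit_monoid : monoid_morphism counit;
  comulA : forall x, tassoc (tmap comul idfun (comul x)) = tmap idfun comul (comul x);
  comul_counitl : forall x, tlift (fun a b => counit a *: b) (comul x) = x;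
  comul_counitr : forall x, tlift (fun a b => counit b *: a) (comul x) = x;
  antipodel : forall x, tlift (fun a b => antipode a * b) (comul x) = (counit x)%:A;
  antipoder : forall x, tlift (fun a b => a * antipode b) (comul x) = (counit x)%:A
}.

Definition hopf_ideal (A : algType R) (H : hopf A) (I : set A) : Prop :=
  [/\ is_subspace I,
      forall a x b, I x -> I (a * x * b),
      forall x, I x ->
        linspan [set t | exists a b, (I a \/ I b) /\ t = tens a b] (comul H x),
      forall x, I x -> counit H x = 0
    & forall x, I x -> I (antipode H x)].

Definition hopf_morphism (A B : algType R) (HA : hopf A) (HB : hopf B)
    (f : A -> B) : Prop :=
  [/\ linear f, monoid_morphism f,
      forall x, comul HB (f x) = tmap f f (comul HA x),
      forall x, counit HB (f x) = counit HA x
    & forall x, antipode HB (f x) = f (antipode HA x)].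

Definition group_like (A : algType R) (H : hopf A) (g : A) : Prop :=
  comul H g = tens g g /\ counit H g = 1.

End Hopf.

Section Pointed.
Variables (k : fieldType) (A : algType k) (H : hopf A).

Definition subcoalgebra (C : set A) : Prop :=
  is_subspace C /\
  forall x, C x ->
    linspan [set t | exists a b, [/\ C a, C b & t = tens a b]] (comul H x).

Definition simple_subcoalgebra (C : set A) : Prop :=
  [/\ subcoalgebra C, C <> [set 0]
    & forall D, subcoalgebra D -> D `<=` C -> D = [set 0] \/ D = C].

Definition pointed : Prop :=
  forall C, simple_subcoalgebra C ->
    exists2 c, c != 0 & C = [set z *: c | z in [set: k]].

Definition findim : Prop :=
  exists (d : nat) (f : {linear A -> 'rV[k]_d}), bijective f.

End Pointed.

Definition freealg (R : comNzRingType) (G : choiceType) : Type :=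
  {malg R[{fmonom G}]}.

HB.instance Definition _ (R : comNzRingType) (G : choiceType) :=
  GRing.Lmodule.on (freealg R G).

HB.lock Definition fgen (R : comNzRingType) (G : choiceType) (g : G) :
  freealg R G := << fmu g >>.

HB.lock Definition freealg_one (R : comNzRingType) (G : choiceType) :
  freealg R G := (1 : {malg R[{fmonom G}]}).

HB.lock Definition freealg_mul (R : comNzRingType) (G : choiceType)
  (x y : freealg R G) : freealg R G := (x : {malg R[{fmonom G}]}) * y.

Section FreeAlgebra.
Variables (R : comNzRingType) (G : choiceType).
Local Notation M := {malg R[{fmonom G}]}.
Local Notation F := (freealg R G).
Local Notation one := (freealg_one R G).
Local Notation mul := (@freealg_mul R G).

Fact freealg_mulA : associative mul.
Proof. by move=> x y z; rewrite freealg_mul.unlock (@mulrA M). Qed.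

Fact freealg_mul1l : left_id one mul.
Proof. by move=> x; rewrite freealg_mul.unlock freealg_one.unlock (@mul1r M). Qed.

Fact freealg_mul1r : right_id one mul.
Proof. by move=> x; rewrite freealg_mul.unlock freealg_one.unlock (@mulr1 M). Qed.

Fact freealg_mulDl : left_distributive mul +%R.
Proof. by move=> x y z; rewrite freealg_mul.unlock (@mulrDl M). Qed.

Fact freealg_mulDr : right_distributive mul +%R.
Proof. by move=> x y z; rewrite freealg_mul.unlock (@mulrDr M). Qed.

Fact freealg_1_neq0 : one != 0.
Proof. rewrite freealg_one.unlock; exact: (@oner_neq0 M). Qed.

HB.instance Definition _ := GRing.Zmodule_isNzRing.Build F
  freealg_mulA freealg_mul1l freealg_mul1r freealg_mulDl freealg_mulDr
  freealg_1_neq0.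

Fact freealg_scaleAl (c : R) (x y : F) : c *: mul x y = mul (c *: x) y.
Proof. rewrite freealg_mul.unlock; exact: (@scalerAl R M). Qed.

HB.instance Definition _ := GRing.Lmodule_isLalgebra.Build R F freealg_scaleAl.

Fact freealg_scaleAr (c : R) (x y : F) : c *: mul x y = mul x (c *: y).
Proof.
have comm : (x : M) * c%:MP = c%:MP * (x : M).
  rewrite [LHS]fgmulgU [RHS]fgmulUg; apply: eq_bigr => m _.
  by rewrite mulrC mulm1 mul1m.
rewrite freealg_mul.unlock.
have -> : c *: y = c%:MP * (y : M) by rewrite mul_malgC.
have -> : c *: ((x : M) * (y : M)) = c%:MP * ((x : M) * (y : M)).
  by rewrite mul_malgC.
by rewrite (@mulrA M c%:MP x y) -comm -(@mulrA M x c%:MP y).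
Qed.

HB.instance Definition _ := GRing.Lalgebra_isAlgebra.Build R F freealg_scaleAr.

Lemma freealgM (x y : F) : x * y = (x : M) * (y : M).
Proof. by rewrite -[LHS]/(mul x y) freealg_mul.unlock. Qed.

End FreeAlgebra.

Section FreeEval.
Variables (R : comNzRingType) (G : choiceType) (a : G -> R).

Definition fword_eval (w : {fmonom G}) : R := \prod_(g <- (w : seq G)) a g.

Fact fword_eval_mmorphism : mmorphism fword_eval.
Proof.
split=> [u v|]; rewrite /fword_eval; first by rewrite fmM big_cat.
by rewrite fm1 big_nil.
Qed.

HB.instance Definition _ :=
  isMultiplicative.Build {fmonom G} R fword_eval fword_eval_mmorphism.

(* The character of the free algebra that sends the generator g to a g. *)
Definition feval : freealg R G -> R := mmap idfun fword_eval.

Fact feval_zmod : zmod_morphism feval.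
Proof. exact: (@mmap_is_additive _ _ _ idfun fword_eval). Qed.

HB.instance Definition _ :=
  GRing.isZmodMorphism.Build (freealg R G) R feval feval_zmod.

Fact feval_monoid : monoid_morphism feval.
Proof.
have [hM h1] := @mmap_is_multiplicative _ _ _ idfun fword_eval; split.
  by rewrite -[1]/(freealg_one R G) freealg_one.unlock.
by move=> x y; rewrite freealgM.
Qed.

HB.instance Definition _ :=
  GRing.isMonoidMorphism.Build (freealg R G) R feval feval_monoid.

Lemma fevalZ : scalable_for *%R feval.
Proof. exact: (@mmap_is_linear _ _ fword_eval). Qed.

Lemma feval_gen g : feval (fgen R g) = a g.
Proof. by rewrite fgen.unlock /feval mmapU /= mul1r /fword_eval fmU big_seq1. Qed.

End FreeEval.

Section Augmentation.
Variables (R : comNzRingType) (A : algType R) (S : set A).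
Variable f : {rmorphism A -> R}.
Hypotheses (fZ : scalable_for *%R f) (fS : forall s, S s -> f s = 0).

Lemma ideal_aug x : ideal S x -> f x = 0.
Proof.
apply: (@linspan_ind _ _ (ideal_gens S) [set x | f x = 0]).
  split=> [|c u v /= fu fv] /=; first by rewrite rmorph0.
  by rewrite rmorphD fZ fu fv mulr0 addr0.
by move=> _ [a [s [b [Ss ->]]]] /=; rewrite !rmorphM (fS Ss) mulr0 mul0r.
Qed.

Lemma ideal_aug_proper : ~ ideal S 1.
Proof. by move/ideal_aug/eqP; rewrite rmorph1 oner_eq0. Qed.

Variable S1 : ~ ideal S 1.

Definition aquot_aug (x : aquot S1) : R := f (lrepr (x : lquot _)).

Lemma aquot_augE x : aquot_aug (api S1 x) = f x.
Proof.
apply/eqP; rewrite -subr_eq0 -rmorphB; apply/eqP/ideal_aug.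
exact: repr_lpi.
Qed.

Fact aquot_aug_zmod : zmod_morphism aquot_aug.
Proof.
move=> x y; elim/api_ind: x => x; elim/api_ind: y => y.
by rewrite -raddfB !aquot_augE raddfB.
Qed.

Fact aquot_aug_monoid : monoid_morphism aquot_aug.
Proof.
split=> [|x y]; first by rewrite -(rmorph1 (api S1)) aquot_augE rmorph1.
elim/api_ind: x => x; elim/api_ind: y => y.
by rewrite -apiM !aquot_augE rmorphM.
Qed.

Lemma aquot_augZ : scalable_for *%R aquot_aug.
Proof. by move=> c x; elim/api_ind: x => x; rewrite -apiZ !aquot_augE fZ. Qed.

End Augmentation.

Definition qint (k : fieldType) (q : k) (l : nat) : k :=
  (q ^+ l - q ^- l) / (q - q^-1).

(* char(q) = l.  If q = -1 the fraction [qint] degenerates to 0 / 0 = 0; this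
   value of q is irrelevant when l >= 3. *)
Definition is_qchar (k : fieldType) (q : k) (l : nat) : Prop :=
  if l == 0%N then forall j, (0 < j)%N -> qint q j <> 0
  else qint q l = 0 /\ forall j, (0 < j < l)%N -> qint q j <> 0.

Section Bicharacter.
Variables (k : fieldType) (q : k) (m n : nat).

Definition star (a b : 'rV[int]_(m + n)) : int :=
  \sum_(i < m + n) \sum_(j < m + n | (j < i)%N) a 0 i * b 0 j.

(* An element of Z_p is read as its representative in {0, ..., p - 1}. *)
Definition zrep (p r : nat) (x : 'rV['Z_p]_r) : 'rV[int]_r :=
  map_mx (fun c : 'Z_p => (c : nat)%:Z) x.

Definition zgrp : Type := ('rV[int]_m * 'rV['Z_2]_n)%type.

Definition theta (x y : zgrp) : k :=
  let al : 'rV[int]_(m + n) := row_mx x.1 0 in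
  let mu : 'rV[int]_(m + n) := row_mx 0 (zrep x.2) in
  let be : 'rV[int]_(m + n) := row_mx y.1 0 in
  let nu : 'rV[int]_(m + n) := row_mx 0 (zrep y.2) in
  (-1) ^ (star mu nu - star nu mu) *
  q ^ (star (al + mu) be - star (be + nu) al + star mu nu - star nu mu).

Definition zbas (i : 'I_(m + n)) : zgrp :=
  match split i with
  | inl i0 => (delta_mx 0 i0, 0)
  | inr i1 => (0, delta_mx 0 i1)
  end.

Definition zgrp_tuple (x : zgrp) : 'rV[int]_(m + n) := row_mx x.1 (zrep x.2).

Definition zgrpN (N : nat) : Type := ('rV['Z_N]_m * 'rV['Z_2]_n)%type.

Definition lift_zgrp (N : nat) (x : zgrpN N) : zgrp := (zrep x.1, x.2).

Definition red_zgrp (N : nat) (x : zgrp) : zgrpN N := (map_mx intr x.1, x.2).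

(* theta on Z_N^m x Z_2^n, evaluated at the representatives in {0, ..., N - 1}.
   When q ^+ N = 1 this is the map induced by theta.  If char(q) = l is odd,
   q ^+ l may also be -1, and then theta does not descend to Z_l^m x Z_2^n. *)
Definition thetaN (N : nat) (x y : zgrpN N) : k :=
  theta (lift_zgrp x) (lift_zgrp y).

End Bicharacter.

Inductive dgen (m n : nat) : Type :=
| GPartial of 'I_(m + n)
| GTheta of 'I_(m + n)
| GThetaV of 'I_(m + n)
| GSigma of 'I_(m + n)
| GSigmaV of 'I_(m + n)
| GTau of 'I_n.

Section DGenChoice.
Variables m n : nat.

Definition dgen_code (g : dgen m n) : 'I_5 * 'I_(m + n) + 'I_n :=
  match g with
  | GPartial i => inl (inord 0, i)
  | GTheta i => inl (inord 1, i)
  | GThetaV i => inl (inord 2, i)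
  | GSigma i => inl (inord 3, i)
  | GSigmaV i => inl (inord 4, i)
  | GTau j => inr j
  end.

Definition dgen_decode (c : 'I_5 * 'I_(m + n) + 'I_n) : dgen m n :=
  match c with
  | inl (c, i) =>
    match val c with
    | 0 => GPartial i | 1 => GTheta i | 2 => GThetaV i | 3 => GSigma i
    | _ => GSigmaV i
    end
  | inr j => GTau _ j
  end.

Fact dgen_codeK : cancel dgen_code dgen_decode.
Proof. by case=> i //=; rewrite inordK. Qed.

HB.instance Definition _ := Choice.copy (dgen m n) (can_type dgen_codeK).

End DGenChoice.

Section QuantumDifferential.
Variables (k : fieldType) (q : k) (m n : nat).

Local Notation F := (freealg k (dgen m n)).
Local Notation gen := (@fgen k (dgen m n)).

(* Indices are 0-based: I_0 = {i < m}, I_1 = {m <= i < m + n}; the generator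
   tau_j, j in I_1, is [wtau j'] with j = rshift m j'. *)
Definition wpart (i : 'I_(m + n)) : F := gen (GPartial i).
Definition wsig (i : 'I_(m + n)) : F := gen (GSigma i).
Definition wsigV (i : 'I_(m + n)) : F := gen (GSigmaV i).
Definition wtheta (i : 'I_(m + n)) : F := gen (GTheta i).
Definition wthetaV (i : 'I_(m + n)) : F := gen (GThetaV i).
Definition wtau (j : 'I_n) : F := gen (GTau m j).

Definition wtauall : F := \prod_(j < n) wtau j.

(* Theta(a) for a in Z^(m+n) *)
Definition wTheta (a : 'rV[int]_(m + n)) : F :=
  \prod_(i < m + n)
    match a 0 i with
    | Posz p => wtheta i ^+ p
    | Negz p => wthetaV i ^+ p.+1
    end.

Definition vec (i : 'I_(m + n)) : 'rV[int]_(m + n) := delta_mx 0 i.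

Definition thetab (i j : 'I_(m + n)) : k := theta q (zbas i) (zbas j).

Inductive drel : F -> F -> Prop :=
| DSigK i : drel (wsig i * wsigV i) 1
| DSigVK i : drel (wsigV i * wsig i) 1
| DSigC i j : drel (wsig i * wsig j) (wsig j * wsig i)
| DTauAll : drel (wtauall ^+ 2) 1
| DTau2 j : drel (wtau j ^+ 2) 1
| DTauC i j : drel (wtau i * wtau j) (wtau j * wtau i)
| DSigTau i j : drel (wsig i * wtau j) (wtau j * wsig i)
| DThetaK i : drel (wtheta i * wthetaV i) 1
| DThetaVK i : drel (wthetaV i * wtheta i) 1
| DThetaD i j : drel (wtheta i * wtheta j) (wTheta (vec i + vec j))
| DThetaC i j : drel (wTheta (vec i + vec j)) (wtheta j * wtheta i)
| DSigTheta i j : drel (wsig j * wtheta i) (wtheta i * wsig j)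
| DTauTheta i j : drel (wtau j * wtheta i) (wtheta i * wtau j)
| DThetaSigm (i i' : 'I_(m + n)) : i' = i.+1 :> nat -> i' = m :> nat ->
    drel (wTheta (- vec i + vec i')) (wtauall * wsig i * wsig i')
| DThetaSig (i i' : 'I_(m + n)) : i' = i.+1 :> nat -> i' <> m :> nat ->
    drel (wTheta (- vec i + vec i')) (wsig i * wsig i')
| DThetaPart i j :
    drel (wtheta j * wpart i * wthetaV j) (thetab i j *: wpart i)
| DSigPart i j :
    drel (wsig j * wpart i * wsigV j)
         (((-1) ^+ ((m <= i)%N && (i == j)) * q ^- (i == j)) *: wpart i)
| DTauPart i j :
    drel (wtau j * wpart i) ((-1) ^+ (i == rshift m j) *: (wpart i * wtau j))
| DPartC i j : drel (wpart i * wpart j) (thetab i j *: (wpart j * wpart i))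
| DPart2 j : drel (wpart (rshift m j) ^+ 2) 0.

Definition drel_set : set F := [set x | exists u v, drel u v /\ x = u - v].

Definition daug (g : dgen m n) : k := if g is GPartial _ then 0 else 1.

Fact feval_wTheta a : feval daug (wTheta a) = 1.
Proof.
rewrite rmorph_prod big1 //= => i _.
by case: (a 0 i) => p; rewrite rmorphXn /= feval_gen expr1n.
Qed.

Fact feval_wtauall : feval daug wtauall = 1.
Proof. by rewrite rmorph_prod big1 //= => i _; rewrite feval_gen. Qed.

Fact drel_aug x : drel_set x -> feval daug x = 0.
Proof.
move=> [u [v [uv ->]]]; apply/eqP; rewrite rmorphB subr_eq0.
have Z c x' : feval daug (c *: x') = c * feval daug x' by exact: fevalZ.
by case: uv => *; rewrite ?(rmorphM, rmorphXn, rmorph1, rmorph0) /=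
  ?(Z, feval_wTheta, feval_wtauall) ?rmorphM /= ?feval_gen /=
  ?(expr1n, mul0r, mulr0, mulr1, expr0n).
Qed.

Fact drel_proper : ~ ideal drel_set 1.
Proof. exact: (ideal_aug_proper (@fevalZ _ _ daug) drel_aug). Qed.

(* The algebra D_q(m|n). *)
Definition Dq : Type := aquot drel_proper.

HB.instance Definition _ := GRing.Algebra.on Dq.

Definition dpi : F -> Dq := api drel_proper.

HB.instance Definition _ := GRing.LRMorphism.copy dpi (api drel_proper).

Definition dpart i : Dq := dpi (wpart i).
Definition dsig i : Dq := dpi (wsig i).
Definition dsigV i : Dq := dpi (wsigV i).
Definition dtheta i : Dq := dpi (wtheta i).
Definition dthetaV i : Dq := dpi (wthetaV i).
Definition dtau j : Dq := dpi (wtau j).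

(* The prescribed Hopf structure; antipodes of group-likes are forced. *)
Definition Dq_hopf_spec (H : hopf Dq) : Prop :=
  [/\ forall i, [/\ group_like H (dsig i), group_like H (dsigV i),
                    group_like H (dtheta i) & group_like H (dthetaV i)],
      forall j, group_like H (dtau j),
      forall i : 'I_(m + n), (i < m)%N ->
        comul H (dpart i) =
          tens (dpart i) (dsigV i) + tens (dthetaV i * dsig i) (dpart i) /\
        antipode H (dpart i) = - (q *: (dtheta i * dpart i)),
      forall j : 'I_n, let i := rshift m j in
        comul H (dpart i) =
          tens (dpart i) 1 + tens (dthetaV i * dtau j) (dpart i) /\
        antipode H (dpart i) = - (dtheta i * dtau j * dpart i)
    & forall i, counit H (dpart i) = 0].

Variable l : nat.

(* The order imposed on the sigma_i and Theta(e_i), given char(q) = l. *)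
Definition tord : nat := if odd l then l else l.*2.

Inductive restr_gens : set Dq :=
| RSig i : restr_gens (dsig i ^+ tord - 1)
| RTheta i : restr_gens (dtheta i ^+ tord - 1)
| RPart (i : 'I_(m + n)) : (i < m)%N -> restr_gens (dpart i ^+ l).

Definition restr_ideal : set Dq := ideal restr_gens.

Definition Dq_aug : Dq -> k := aquot_aug (S1 := drel_proper) (feval daug).

HB.instance Definition _ := GRing.isZmodMorphism.Build Dq k Dq_aug
  (aquot_aug_zmod (@fevalZ _ _ daug) drel_aug (S1 := drel_proper)).

HB.instance Definition _ := GRing.isMonoidMorphism.Build Dq k Dq_aug
  (aquot_aug_monoid (@fevalZ _ _ daug) drel_aug drel_proper).

Lemma Dq_augZ : scalable_for *%R Dq_aug.
Proof. exact: (aquot_augZ (@fevalZ _ _ daug) drel_aug (S1 := drel_proper)). Qed.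

Fact dpi_aug x : Dq_aug (dpi x) = feval daug x.
Proof. exact: (aquot_augE (@fevalZ _ _ daug) drel_aug). Qed.

Fact restr_aug (l_gt2 : (2 < l)%N) x : restr_gens x -> Dq_aug x = 0.
Proof.
case=> [i|i|i _]; rewrite ?(rmorphB, rmorph1) /= rmorphXn /= dpi_aug feval_gen /=.
- by rewrite expr1n subrr.
- by rewrite expr1n subrr.
- by rewrite expr0n; case: (l) l_gt2.
Qed.

Fact restr_proper : (2 < l)%N -> ~ restr_ideal 1.
Proof.
move=> l_gt2; exact: (ideal_aug_proper Dq_augZ (restr_aug l_gt2)).
Qed.

(* The quotient of [Dq] by [restr_ideal]. *)
Definition Dq1 (l_gt2 : (2 < l)%N) : Type := aquot (restr_proper l_gt2).

HB.instance Definition _ (l_gt2 : (2 < l)%N) := GRing.Algebra.on (Dq1 l_gt2).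

Definition rpi (l_gt2 : (2 < l)%N) : Dq -> Dq1 l_gt2 := api (restr_proper l_gt2).

HB.instance Definition _ (l_gt2 : (2 < l)%N) :=
  GRing.LRMorphism.copy (rpi l_gt2) (api (restr_proper l_gt2)).

End QuantumDifferential.

Section Associated.
Variables (k : fieldType) (q : k) (m n N : nat) (A : algType k).
Variables part Th : 'I_(m + n) -> A.

Definition zmonomial (g : 'I_(m + n) -> A) (x : zgrpN m n N) : A :=
  \prod_(i < m + n) g i ^+ `|zgrp_tuple (lift_zgrp x) 0%R i|%N.

(* A is associated with theta over Z_N^m x Z_2^n: the monomials in the
   derivations and in the group-likes Theta commute up to theta. *)
Definition theta_associated : Prop :=
  forall x y : zgrpN m n N,
    zmonomial Th y * zmonomial part x =
      thetaN q x y *: (zmonomial part x * zmonomial Th y) /\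
    zmonomial part x * zmonomial part y =
      thetaN q x y *: (zmonomial part y * zmonomial part x).

End Associated.

(* Main.v *)
Require Import Defs.
From HB Require Import structures.
From mathcomp Require Import all_boot all_order all_algebra.
From mathcomp Require Import boolp classical_sets.
From mathcomp Require Import finmap monalg ring zify.

Set Implicit Arguments.
Unset Strict Implicit.
Unset Printing Implicit Defensive.

Import GRing.Theory.

Local Open Scope classical_set_scope.
Local Open Scope ring_scope.

(** Call an element skew-primitive if its coproduct is p (x) g + h (x) p with g and
    h group-like. The algebra D_q(m|n) is generated by group-likes that commute with
    each other and by the skew-primitive partial_i, and any two generators commute up
    to a scalar.

    A multiplicative comultiplication and counit together with an
    antimultiplicative antipode satisfy the Hopf axioms as soon as they do so on
    generators ([hopf_axioms_gen]). So it suffices that the prescribed values respect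
    the defining relations ([free_maps_drel]). For relations among group-likes this
    is automatic, because the coproduct of a product of group-likes is the tensor
    square of its value. Relations that involve some partial_i reduce to the scalars
    by which r_i and h_i commute with the partial_j, where
    partial_i (x) r_i + h_i (x) partial_i is the coproduct of partial_i.

    The restricted ideal is a Hopf ideal ([restricted_hopf_ideal]): for even i the
    two terms of the coproduct of partial_i commute up to q^-2, which is a primitive
    l-th root of unity, so the q-binomial theorem leaves only the two extreme terms
    of the l-th power ([qbinomial_root]). Quotients by Hopf ideals are Hopf algebras
    ([quotient_hopf]).

    In the quotient every generator commutes up to scalars with the others and has
    some power equal to 0 or 1, or is a power of such a generator. Hence the ordered
    monomials with bounded exponents span it ([qcommuting_finite_span]).

    For pointedness ([pointed_of_skew_generated]), filter the algebra by the number
    of skew-primitive factors. If a subcoalgebra contains x outside the span of the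
    group-likes, a functional f that kills this span and not x gives the nonzero
    element (id (x) f)(Delta x) of the subcoalgebra, of smaller degree. So every
    nonzero subcoalgebra meets the span of the group-likes, and then, by slicing with
    a functional dual to one of them, contains a group-like. A simple subcoalgebra is
    therefore a line.

    Finally theta is the bimultiplicative extension of its values on basis vectors
    ([theta_prod]), so monomials commute up to theta because the generators do, and
    theta depends only on the classes mod N of the even coordinates when q^N = 1. *)

(** * Linear maps, spans and tensors *)

Section Linear.
Variable R : comNzRingType.

Definition linear_of (U V : lmodType R) (f : U -> V) (fL : linear f) :
    {linear U -> V} :=
  HB.pack f (GRing.isLinear.Build R U V *:%R f fL).

Definition scalar_of (U : lmodType R) (f : U -> R) (fL : scalar f) :
    {scalar U} :=
  HB.pack f (GRing.isLinear.Build R U R *%R f fL).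

Lemma subspaceD (V : lmodType R) (W : set V) u v :
  is_subspace W -> W u -> W v -> W (u + v).
Proof. by move=> [_ h] Wu Wv; rewrite -[u]scale1r; apply: h. Qed.

Lemma subspaceZ (V : lmodType R) (W : set V) c u :
  is_subspace W -> W u -> W (c *: u).
Proof. by move=> [h0 h] Wu; rewrite -[_ *: _]addr0; apply: h. Qed.

Lemma subspace_sum (V : lmodType R) (W : set V) (I : Type) (r : seq I)
    (P : pred I) (F : I -> V) :
  is_subspace W -> (forall i, P i -> W (F i)) -> W (\sum_(i <- r | P i) F i).
Proof.
move=> h WF; apply: (big_ind W) => //; first exact: h.1.
by move=> u v; apply: subspaceD.
Qed.

Lemma preimage_subspace (U V : lmodType R) (f : {linear U -> V}) (W : set V) :
  is_subspace W -> is_subspace [set x | W (f x)].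
Proof.
by move=> [h0 h]; split=> [|c u v Wu Wv] /=; rewrite ?linear0 ?linearP //; apply: h.
Qed.

Lemma linspanS (V : lmodType R) (S T : set V) : S `<=` T -> linspan S `<=` linspan T.
Proof.
move=> ST; apply: linspan_ind; first exact: linspan_subspace.
by move=> x /ST; apply: linspan_gen.
Qed.

(** Used for f a multiplication map, a coproduct, an antipode or a slice of a
    coproduct, to transport ideals, subcoalgebras and filtrations. *)
Lemma linspan_image (U V : lmodType R) (f : {linear U -> V}) (S : set U)
    (W : set V) x :
  is_subspace W -> (forall s, S s -> W (f s)) -> linspan S x -> W (f x).
Proof.
by move=> hW fS; apply: (linspan_ind (preimage_subspace f hW)).
Qed.

Lemma equalizer_subspace (U V : lmodType R) (f g : {linear U -> V}) :
  is_subspace [set x | f x = g x].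
Proof.
by split=> [|c u v /= fu fv] /=; rewrite ?linear0 ?linearP ?fu ?fv.
Qed.

End Linear.

Section Tensors.
Variable R : comNzRingType.

Section Basic.
Variables A B : lmodType R.

Lemma tens0l (b : B) : tens (0 : A) b = 0.
Proof. by have := tensL (-1) (0 : A) 0 b; rewrite scaler0 addr0 scaleN1r addNr. Qed.

Lemma tens0r (a : A) : tens a (0 : B) = 0.
Proof. by have := tensR (-1) a (0 : B) 0; rewrite scaler0 addr0 scaleN1r addNr. Qed.

Lemma tensZl c (a : A) (b : B) : tens (c *: a) b = c *: tens a b.
Proof. by rewrite -[c *: a]addr0 tensL tens0l addr0. Qed.

Lemma tensZr c (a : A) (b : B) : tens a (c *: b) = c *: tens a b.
Proof. by rewrite -[c *: b]addr0 tensR tens0r addr0. Qed.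

Lemma tensDl (a a' : A) (b : B) : tens (a + a') b = tens a b + tens a' b.
Proof. by rewrite -[a]scale1r tensL !scale1r. Qed.

Lemma tensDr (a : A) (b b' : B) : tens a (b + b') = tens a b + tens a b'.
Proof. by rewrite -[b]scale1r tensR !scale1r. Qed.

Lemma tensBl (a a' : A) (b : B) : tens (a - a') b = tens a b - tens a' b.
Proof. by rewrite tensDl -scaleN1r tensZl scaleN1r. Qed.

Lemma tensBr (a : A) (b b' : B) : tens a (b - b') = tens a b - tens a b'.
Proof. by rewrite tensDr -scaleN1r tensZr scaleN1r. Qed.

Lemma tensor_ext (V : lmodType R) (f g : {linear tensor A B -> V}) :
  (forall a b, f (tens a b) = g (tens a b)) -> f =1 g.
Proof.
by move=> fg; apply: tensor_ind => // c x y fx fy; rewrite !linearP fx fy.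
Qed.

Definition tlift_lin (V : lmodType R) (f : A -> B -> V) (fL : bilinear_fun f) :
  {linear tensor A B -> V} := linear_of (tlift_linear fL).

End Basic.

Section Maps.

Fact tmap_bilinear (A B C D : lmodType R) (f : {linear A -> C}) (g : {linear B -> D}) :
  bilinear_fun (fun a b => tens (f a) (g b)).
Proof. by split=> [b|a] c u v; rewrite linearP ?tensL ?tensR. Qed.

Lemma tmapE (A B C D : lmodType R) (f : {linear A -> C}) (g : {linear B -> D}) a b :
  tmap f g (tens a b) = tens (f a) (g b).
Proof. by rewrite /tmap (tliftE (tmap_bilinear f g)). Qed.

Lemma tmap_linear (A B C D : lmodType R) (f : {linear A -> C}) (g : {linear B -> D}) :
  linear (tmap f g).
Proof. exact: (tlift_linear (tmap_bilinear f g)). Qed.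

Definition tmap_lin (A B C D : lmodType R) (f : {linear A -> C}) (g : {linear B -> D}) :=
  linear_of (tmap_linear f g).

Lemma tmapD (A B C D : lmodType R) (f : {linear A -> C}) (g : {linear B -> D}) t u :
  tmap f g (t + u) = tmap f g t + tmap f g u.
Proof. exact: (raddfD (tmap_lin f g)). Qed.

Variables A B C : lmodType R.

Fact tassoc_inner_bilinear (c : C) :
  bilinear_fun (fun (a : A) (b : B) => tens a (tens b c)).
Proof. by split=> [b|a] d u v; rewrite ?tensL ?tensR. Qed.

Fact tassoc_bilinear :
  bilinear_fun (fun (t : tensor A B) (c : C) =>
                  tlift (fun a b => tens a (tens b c)) t).
Proof.
split=> [c|t]; first exact: (tlift_linear (tassoc_inner_bilinear c)).
move=> d u v; move: t; apply: tensor_ind => [a b|e x y Hx Hy].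
  by rewrite !(tliftE (tassoc_inner_bilinear _)) tensR tensR.
rewrite !(tlift_linear (tassoc_inner_bilinear _)) Hx Hy.
by rewrite !scalerDr !scalerA [e * d]mulrC addrACA.
Qed.

Lemma tassocE a b c : tassoc (tens (tens a b) c) = tens a (tens b c)
  :> tensor A (tensor B C).
Proof.
by rewrite /tassoc (tliftE tassoc_bilinear) (tliftE (tassoc_inner_bilinear _)).
Qed.

Lemma tassoc_linear : linear (@tassoc R A B C).
Proof. exact: (tlift_linear tassoc_bilinear). Qed.

Definition tassoc_lin := linear_of tassoc_linear.

Lemma tassocD t u : tassoc (t + u) = tassoc t + tassoc u :> tensor A (tensor B C).
Proof. exact: (raddfD tassoc_lin). Qed.

End Maps.

End Tensors.

(** * Hopf structures determined on generators *)

Definition generates (R : comNzRingType) (A : algType R) (G : set A) : Prop :=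
  forall P : set A, is_subspace P -> P 1 ->
    (forall g x, G g -> P x -> P (g * x)) -> forall x, P x.

Section TensorScale.
Variables (R : comNzRingType) (A B : algType R).
Local Notation T := (tensor A B).

Lemma tensor_mulZl (c : R) (x y : T) : c *: (x * y) = (c *: x) * y.
Proof.
have h0 : tensor_mul 0 y = 0 := mul0r y.
by have := tensor_mul_linl y c x 0; rewrite h0 !addr0.
Qed.

Lemma tensor_mulZr (c : R) (x y : T) : c *: (x * y) = x * (c *: y).
Proof.
have h0 : tensor_mul x 0 = 0 := mulr0 x.
by have := tensor_mul_linr x c y 0; rewrite h0 !addr0.
Qed.

Lemma tensor_mulPl (c : R) (x y z : T) : (c *: x + y) * z = c *: (x * z) + y * z.
Proof. by rewrite mulrDl tensor_mulZl. Qed.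

Lemma tensor_mulPr (c : R) (x y z : T) : z * (c *: x + y) = c *: (z * x) + z * y.
Proof. by rewrite mulrDr tensor_mulZr. Qed.

End TensorScale.

Section HopfFromGenerators.
Variables (R : comNzRingType) (A : algType R).
Local Notation T := (tensor A A).
Local Notation T3 := (tensor A T).

(** With this product both sides of coassociativity are multiplicative. It is
    written out because the ring structure of a tensor product asks for factors in
    which 1 != 0. *)
Let mul3 (u v : T3) : T3 :=
  tlift (fun (a : A) (s : T) => tlift (fun (b : A) (t : T) => tens (a * b) (s * t)) v) u.

Fact mul3_inner_bilinear (a : A) (s : T) :
  bilinear_fun (fun (b : A) (t : T) => tens (a * b) (s * t)).
Proof.
split=> [t c u v|b c u v].
  by rewrite mulrDr -scalerAr tensL.
by rewrite mulrDr -tensor_mulZr tensR.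
Qed.

Fact mul3_bilinear (v : T3) :
  bilinear_fun (fun (a : A) (s : T) =>
                  tlift (fun (b : A) (t : T) => tens (a * b) (s * t)) v).
Proof.
split=> [s c x y|a c x y]; move: v; apply: tensor_ind.
- move=> b t; rewrite !(tliftE (mul3_inner_bilinear _ _)).
  by rewrite mulrDl -scalerAl tensL.
- move=> d u w Hu Hw; rewrite !(tlift_linear (mul3_inner_bilinear _ _)) Hu Hw.
  by rewrite !scalerDr !scalerA [d * c]mulrC addrACA.
- move=> b t; rewrite !(tliftE (mul3_inner_bilinear _ _)).
  by rewrite mulrDl -tensor_mulZl tensR.
- move=> d u w Hu Hw; rewrite !(tlift_linear (mul3_inner_bilinear _ _)) Hu Hw.
  by rewrite !scalerDr !scalerA [d * c]mulrC addrACA.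
Qed.

Let mul3E a s b t : mul3 (tens a s) (tens b t) = tens (a * b) (s * t).
Proof. by rewrite /mul3 (tliftE (mul3_bilinear _)) (tliftE (mul3_inner_bilinear _ _)). Qed.

Let mul3Pl v : linear (mul3^~ v).
Proof. exact: (tlift_linear (mul3_bilinear v)). Qed.

Let mul3Pr u : linear (mul3 u).
Proof.
move=> c v w; move: u; apply: tensor_ind => [a b|d x y Hx Hy].
  by rewrite /mul3 !(tliftE (mul3_bilinear _)) (tlift_linear (mul3_inner_bilinear _ _)).
by rewrite !mul3Pl Hx Hy !scalerDr !scalerA [d * c]mulrC addrACA.
Qed.

(** Reassociation is multiplicative; this is what makes coassociativity pass to
    products. *)
Lemma tassoc_mul3 (s s' : T) (b b' : A) :
  tassoc (tens (s * s') (b * b')) = mul3 (tassoc (tens s b)) (tassoc (tens s' b')).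
Proof.
have L := @tassoc_linear R A A A.
move: s; apply: tensor_ind => [a1 a2|c x y Hx Hy]; last first.
  by rewrite tensor_mulPl !tensL !L mul3Pl Hx Hy.
move: s'; apply: tensor_ind => [a1' a2'|c x y Hx Hy]; last first.
  by rewrite tensor_mulPr !tensL !L mul3Pr Hx Hy.
by rewrite tensM !tassocE mul3E tensM.
Qed.

Variables (D : {linear A -> T}) (e : {scalar A}) (S : {linear A -> A}).
Hypotheses (DM : monoid_morphism D) (eM : monoid_morphism e).
Hypotheses (S1 : S 1 = 1) (SM : forall x y : A, S (x * y) = S y * S x).

Let coass x : Prop := tassoc (tmap D idfun (D x)) = tmap idfun D (D x).

Let coass_l_lin : {linear A -> T3} := @tassoc_lin R A A A \o tmap_lin D idfun \o D.
Let coass_r_lin : {linear A -> T3} := tmap_lin idfun D \o D.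

Let coass_l_mul t t' :
  tassoc (tmap D idfun (t * t')) =
  mul3 (tassoc (tmap D idfun t)) (tassoc (tmap D idfun t')).
Proof.
have L := @tassoc_linear R A A A.
move: t; apply: tensor_ind => [a b|c x y Hx Hy]; last first.
  by rewrite tensor_mulPl !tmap_linear !L mul3Pl Hx Hy.
move: t'; apply: tensor_ind => [a' b'|c x y Hx Hy]; last first.
  by rewrite tensor_mulPr !tmap_linear !L mul3Pr Hx Hy.
by rewrite tensM !tmapE DM.2 tassoc_mul3.
Qed.

Let coass_r_mul t t' :
  tmap idfun D (t * t') = mul3 (tmap idfun D t) (tmap idfun D t').
Proof.
move: t; apply: tensor_ind => [a b|c x y Hx Hy]; last first.
  by rewrite tensor_mulPl !tmap_linear mul3Pl Hx Hy.
move: t'; apply: tensor_ind => [a' b'|c x y Hx Hy]; last first.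
  by rewrite tensor_mulPr !tmap_linear mul3Pr Hx Hy.
by rewrite tensM !tmapE DM.2 mul3E.
Qed.

Let coass1 : coass 1.
Proof. by rewrite /coass DM.1 !tmapE DM.1 tassocE. Qed.

Let coassM x y : coass x -> coass y -> coass (x * y).
Proof. by rewrite /coass => cx cy; rewrite DM.2 coass_l_mul coass_r_mul cx cy. Qed.

Fact counitl_bilinear : bilinear_fun (fun (a : A) (b : A) => e a *: b).
Proof.
split=> [b|a] c u v; first by rewrite linearP scalerDl scalerA.
by rewrite scalerDr !scalerA mulrC.
Qed.

Fact counitr_bilinear : bilinear_fun (fun (a : A) (b : A) => e b *: a).
Proof.
split=> [b|a] c u v; last by rewrite linearP scalerDl scalerA.
by rewrite scalerDr !scalerA mulrC.
Qed.

Fact antipodel_bilinear : bilinear_fun (fun (a : A) (b : A) => S a * b).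
Proof.
split=> [b|a] c u v; last by rewrite mulrDr scalerAr.
by rewrite linearP mulrDl scalerAl.
Qed.

Fact antipoder_bilinear : bilinear_fun (fun (a : A) (b : A) => a * S b).
Proof.
split=> [b|a] c u v; first by rewrite mulrDl scalerAl.
by rewrite linearP mulrDr scalerAr.
Qed.

Let ul := tlift_lin counitl_bilinear.
Let ur := tlift_lin counitr_bilinear.
Let al := tlift_lin antipodel_bilinear.
Let ar := tlift_lin antipoder_bilinear.

Let ulE a b : ul (tens a b) = e a *: b. Proof. exact: tliftE counitl_bilinear _ _. Qed.
Let urE a b : ur (tens a b) = e b *: a. Proof. exact: tliftE counitr_bilinear _ _. Qed.
Let alE a b : al (tens a b) = S a * b. Proof. exact: tliftE antipodel_bilinear _ _. Qed.
Let arE a b : ar (tens a b) = a * S b. Proof. exact: tliftE antipoder_bilinear _ _. Qed.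

Let ulM t t' : ul (t * t') = ul t * ul t'.
Proof.
move: t; apply: tensor_ind => [a b|c x y Hx Hy]; last first.
  by rewrite tensor_mulPl !linearP Hx Hy mulrDl scalerAl.
move: t'; apply: tensor_ind => [a' b'|c x y Hx Hy]; last first.
  by rewrite tensor_mulPr !linearP Hx Hy mulrDr scalerAr.
by rewrite tensM !ulE eM.2 -scalerAl -scalerAr scalerA.
Qed.

Let urM t t' : ur (t * t') = ur t * ur t'.
Proof.
move: t; apply: tensor_ind => [a b|c x y Hx Hy]; last first.
  by rewrite tensor_mulPl !linearP Hx Hy mulrDl scalerAl.
move: t'; apply: tensor_ind => [a' b'|c x y Hx Hy]; last first.
  by rewrite tensor_mulPr !linearP Hx Hy mulrDr scalerAr.
by rewrite tensM !urE eM.2 -scalerAl -scalerAr scalerA.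
Qed.

(** Multiplying by a pure tensor wraps the value between S a and b, because S
    reverses products: this is how the antipode axiom passes from factors to
    products although the convolution S * id is not multiplicative. *)
Let alM_tens t a b : al (t * tens a b) = S a * al t * b.
Proof.
move: t; apply: tensor_ind => [a' b'|c x y Hx Hy]; last first.
  by rewrite tensor_mulPl !linearP Hx Hy mulrDr mulrDl -scalerAr -scalerAl.
by rewrite tensM !alE SM !mulrA.
Qed.

Let arM_tens t a b : ar (tens a b * t) = a * ar t * S b.
Proof.
move: t; apply: tensor_ind => [a' b'|c x y Hx Hy]; last first.
  by rewrite tensor_mulPr !linearP Hx Hy mulrDr mulrDl -scalerAr -scalerAl.
by rewrite tensM !arE SM !mulrA.
Qed.

Let alM x y : al (D x) = (e x)%:A -> al (D y) = (e y)%:A ->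
  al (D (x * y)) = (e (x * y))%:A.
Proof.
move=> ax ay; rewrite DM.2 eM.2.
suff -> t : al (D x * t) = e x *: al t by rewrite ay scalerA.
move: t; apply: tensor_ind => [a b|c u v Hu Hv]; last first.
  by rewrite tensor_mulPr !linearP Hu Hv.
by rewrite alM_tens ax alE -scalerAr mulr1 -scalerAl.
Qed.

Let arM x y : ar (D x) = (e x)%:A -> ar (D y) = (e y)%:A ->
  ar (D (x * y)) = (e (x * y))%:A.
Proof.
move=> ax ay; rewrite DM.2 eM.2.
suff -> t : ar (t * D y) = e y *: ar t by rewrite ax scalerA mulrC.
move: t; apply: tensor_ind => [a b|c u v Hu Hv]; last first.
  by rewrite tensor_mulPl !linearP Hu Hv.
by rewrite arM_tens ay arE -scalerAr mulr1 -scalerAl.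
Qed.

Variable G : set A.
Hypothesis genG : generates G.

Definition hopf_axioms_at (x : A) : Prop :=
  [/\ tassoc (tmap D idfun (D x)) = tmap idfun D (D x),
      tlift (fun a b => e a *: b) (D x) = x,
      tlift (fun a b => e b *: a) (D x) = x,
      tlift (fun a b => S a * b) (D x) = (e x)%:A
    & tlift (fun a b => a * S b) (D x) = (e x)%:A].

Let unit_lin : {linear A -> A} :=
  linear_of (f := fun x => (e x)%:A)
    (fun c u v => ltac:(by rewrite /= linearP scalerDl scalerA)).

(** Each axiom is an equality of linear maps, and it passes to products: the
    comultiplication and the counit are multiplicative and the antipode reverses
    products. So the axioms propagate from generators to the whole algebra. *)
Lemma hopf_axioms_gen : (forall g, G g -> hopf_axioms_at g) ->
  forall x, hopf_axioms_at x.
Proof.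
move=> HG; apply: genG.
- have h1 := equalizer_subspace coass_l_lin coass_r_lin.
  have h2 := equalizer_subspace (ul \o D) idfun.
  have h3 := equalizer_subspace (ur \o D) idfun.
  have h4 := equalizer_subspace (al \o D) unit_lin.
  have h5 := equalizer_subspace (ar \o D) unit_lin.
  split; first by split; [apply h1.1|apply h2.1|apply h3.1|apply h4.1|apply h5.1].
  move=> c u v [u1 u2 u3 u4 u5] [v1 v2 v3 v4 v5].
  by split; [apply h1.2|apply h2.2|apply h3.2|apply h4.2|apply h5.2].
- split; [exact: coass1|..].
  + by rewrite -[LHS]/(ul _) DM.1 ulE eM.1 scale1r.
  + by rewrite -[LHS]/(ur _) DM.1 urE eM.1 scale1r.
  + by rewrite -[LHS]/(al _) DM.1 alE eM.1 scale1r S1 mulr1.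
  + by rewrite -[LHS]/(ar _) DM.1 arE eM.1 scale1r S1 mulr1.
move=> g x /HG [g1 g2 g3 g4 g5] [x1 x2 x3 x4 x5]; split.
- exact: coassM.
- by rewrite -[LHS]/(ul _) DM.2 ulM [ul _]g2 [ul _]x2.
- by rewrite -[LHS]/(ur _) DM.2 urM [ur _]g3 [ur _]x3.
- exact: alM.
- exact: arM.
Qed.

Definition hopf_of_generators (HG : forall g, G g -> hopf_axioms_at g) : hopf A :=
  @Hopf R A D e S DM eM
    (fun x => let: And5 h _ _ _ _ := hopf_axioms_gen HG x in h)
    (fun x => let: And5 _ h _ _ _ := hopf_axioms_gen HG x in h)
    (fun x => let: And5 _ _ h _ _ := hopf_axioms_gen HG x in h)
    (fun x => let: And5 _ _ _ h _ := hopf_axioms_gen HG x in h)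
    (fun x => let: And5 _ _ _ _ h := hopf_axioms_gen HG x in h).

Lemma hopf_axioms_group_like g h : D g = tens g g -> e g = 1 ->
  S g = h -> g * h = 1 -> h * g = 1 -> hopf_axioms_at g.
Proof.
move=> Dg eg Sg gh hg; split.
- by rewrite Dg !tmapE Dg tassocE.
- by rewrite -[LHS]/(ul _) Dg ulE eg scale1r.
- by rewrite -[LHS]/(ur _) Dg urE eg scale1r.
- by rewrite -[LHS]/(al _) Dg alE Sg eg scale1r.
- by rewrite -[LHS]/(ar _) Dg arE Sg eg scale1r.
Qed.

(** When S inverts g and h, the last two hypotheses both say that
    S x = - h^-1 x g^-1. *)
Lemma hopf_axioms_skew x g h : D g = tens g g -> D h = tens h h ->
  e g = 1 -> e h = 1 ->
  D x = tens x g + tens h x -> e x = 0 ->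
  S x * g + S h * x = 0 -> x * S g + h * S x = 0 -> hopf_axioms_at x.
Proof.
move=> Dg Dh eg eh Dx ex Sl Sr; split.
- by rewrite Dx !tmapD !tmapE Dx Dg Dh tensDl tensDr !tassocD !tassocE !addrA.
- by rewrite -[LHS]/(ul _) Dx linearD !ulE eh ex scale1r scale0r add0r.
- by rewrite -[LHS]/(ur _) Dx linearD !urE eg ex scale1r scale0r addr0.
- by rewrite -[LHS]/(al _) Dx linearD !alE ex scale0r.
- by rewrite -[LHS]/(ar _) Dx linearD !arE ex scale0r.
Qed.

End HopfFromGenerators.

(** * Quotients by Hopf ideals *)

Section QuotientLift.
Variables (R : comNzRingType) (A : algType R) (S : set A) (S1 : ~ ideal S 1).
Variables (V : lmodType R) (f : {linear A -> V}).
Hypothesis fS : forall x, ideal S x -> f x = 0.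

Definition aquot_lift_fun (x : aquot S1) : V := lquot_lift f (x : lquot _).

(** [lquot_lift] evaluates at a representative, which is harmless as soon as f
    kills the ideal. *)
Lemma aquot_lift_funE x : aquot_lift_fun (api S1 x) = f x.
Proof.
apply: lquot_liftE => [c u v|s Ss]; first by rewrite linearP.
by apply: fS; apply: linspan_gen.
Qed.

Fact aquot_lift_linear : linear aquot_lift_fun.
Proof.
move=> c x y; elim/api_ind: x => x; elim/api_ind: y => y.
by rewrite -apiZ -raddfD !aquot_lift_funE linearP.
Qed.

Definition aquot_lift : {linear aquot S1 -> V} := linear_of aquot_lift_linear.

Lemma aquot_liftE x : aquot_lift (api S1 x) = f x.
Proof. exact: aquot_lift_funE. Qed.

End QuotientLift.

Lemma ideal_api0 (R : comNzRingType) (A : algType R) (S : set A)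
    (S1 : ~ ideal S 1) x : ideal S x -> api S1 x = 0.
Proof. by move=> Sx; rewrite -(raddf0 (api S1)); apply/apiP; rewrite subr0. Qed.

Section QuotientHopf.
Variables (R : comNzRingType) (A : algType R) (S : set A) (S1 : ~ ideal S 1).
Variable H : hopf A.
Hypothesis HI : hopf_ideal H (ideal S).

Local Notation Q := (aquot S1).
Local Notation pi := (api S1).

(** The axioms hold downstairs because pi (x) pi is onto: both sides of each
    axiom, composed with pi, are images of the two sides upstairs. *)
Section QuotientMaps.
Variables (D : {linear Q -> tensor Q Q}) (e : {scalar Q}) (s : {linear Q -> Q}).
Hypotheses (DE : forall x, D (pi x) = tmap pi pi (comul H x))
  (eE : forall x, e (pi x) = counit H x)
  (sE : forall x, s (pi x) = pi (antipode H x)).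

Let DM : monoid_morphism D.
Proof.
split=> [|x y].
  by rewrite -(rmorph1 pi) DE (comul_monoid H).1 tmapE.
elim/api_ind: x => x; elim/api_ind: y => y.
rewrite -apiM !DE (comul_monoid H).2.
move: (comul H x) (comul H y) => t t'.
move: t; apply: tensor_ind => [a b|c u v Hu Hv]; last first.
  by rewrite tensor_mulPl !tmap_linear tensor_mulPl Hu Hv.
move: t'; apply: tensor_ind => [a' b'|c u v Hu Hv]; last first.
  by rewrite tensor_mulPr !tmap_linear tensor_mulPr Hu Hv.
by rewrite tensM !tmapE tensM /= !apiM.
Qed.

Let eM : monoid_morphism e.
Proof.
split=> [|x y]; first by rewrite -(rmorph1 pi) eE (counit_monoid H).1.
elim/api_ind: x => x; elim/api_ind: y => y.
by rewrite -apiM !eE (counit_monoid H).2.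
Qed.

Let ext (V : lmodType R) (f : {linear tensor Q Q -> V}) (g : {linear tensor A A -> V}) :
  (forall a b, f (tens (pi a) (pi b)) = g (tens a b)) ->
  forall t, f (tmap pi pi t) = g t.
Proof.
move=> fg; apply: (tensor_ext (f := f \o tmap_lin pi pi)) => a b /=.
by rewrite tmapE /= fg.
Qed.

Let coassQ x : tassoc (tmap D idfun (D x)) = tmap idfun D (D x).
Proof.
elim/api_ind: x => x; rewrite DE.
have hl t : tassoc (tmap D idfun (tmap pi pi t)) =
    tmap pi (tmap_lin pi pi) (tassoc (tmap (comul H) idfun t)).
  have := @ext _ (tassoc_lin Q Q Q \o tmap_lin D idfun)
    (tmap_lin pi (tmap_lin pi pi) \o (tassoc_lin A A A \o tmap_lin (comul H) idfun)).
  apply=> a b /=; rewrite !tmapE /= DE; move: (comul H a) => u.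
  have := @tensor_ext _ _ _ _
    (tassoc_lin Q Q Q \o (linear_of (fun c x y => tensL c x y (pi b))
                          \o tmap_lin pi pi))
    (tmap_lin pi (tmap_lin pi pi) \o (tassoc_lin A A A
      \o linear_of (fun c x y => tensL c x y b))).
  by apply=> a1 a2; rewrite /= tmapE !tassocE (tmapE pi (tmap_lin pi pi)) /= tmapE.
have hr t : tmap idfun D (tmap pi pi t) =
    tmap pi (tmap_lin pi pi) (tmap idfun (comul H) t).
  have := @ext _ (tmap_lin idfun D)
    (tmap_lin pi (tmap_lin pi pi) \o tmap_lin idfun (comul H)).
  by apply=> a b; rewrite /= !tmapE /= DE (tmapE pi (tmap_lin pi pi)).
by rewrite hl hr comulA.
Qed.

Let counitlQ x : tlift (fun a b => e a *: b) (D x) = x.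
Proof.
elim/api_ind: x => x; rewrite DE -[in RHS](comul_counitl H x).
have := @ext _ (tlift_lin (counitl_bilinear e))
  (pi \o tlift_lin (counitl_bilinear (counit H))).
by apply=> a b; rewrite /= !tliftE ?apiZ ?eE //; apply: counitl_bilinear.
Qed.

Let counitrQ x : tlift (fun a b => e b *: a) (D x) = x.
Proof.
elim/api_ind: x => x; rewrite DE -[in RHS](comul_counitr H x).
have := @ext _ (tlift_lin (counitr_bilinear e))
  (pi \o tlift_lin (counitr_bilinear (counit H))).
by apply=> a b; rewrite /= !tliftE ?apiZ ?eE //; apply: counitr_bilinear.
Qed.

Let antipodelQ x : tlift (fun a b => s a * b) (D x) = (e x)%:A.
Proof.
elim/api_ind: x => x; rewrite DE eE -(rmorph1 pi) -apiZ -(antipodel H x).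
have := @ext _ (tlift_lin (antipodel_bilinear s))
  (pi \o tlift_lin (antipodel_bilinear (antipode H))).
by apply=> a b; rewrite /= !tliftE ?apiM ?sE //; apply: antipodel_bilinear.
Qed.

Let antipoderQ x : tlift (fun a b => a * s b) (D x) = (e x)%:A.
Proof.
elim/api_ind: x => x; rewrite DE eE -(rmorph1 pi) -apiZ -(antipoder H x).
have := @ext _ (tlift_lin (antipoder_bilinear s))
  (pi \o tlift_lin (antipoder_bilinear (antipode H))).
by apply=> a b; rewrite /= !tliftE ?apiM ?sE //; apply: antipoder_bilinear.
Qed.

Definition hopf_of_quotient_maps : hopf Q :=
  @Hopf R Q D e s DM eM coassQ counitlQ counitrQ antipodelQ antipoderQ.

End QuotientMaps.

Let counit_lin : {linear A -> R^o} :=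
  linear_of (f := fun x : A => counit H x : R^o)
    (fun c u v => linearP (counit H) c u v).

Fact comul_ideal x : ideal S x -> (tmap_lin pi pi \o comul H) x = 0.
Proof.
move=> Ix; have [_ _ hD _ _] := HI; have := hD _ Ix.
apply: (linspan_image (f := tmap_lin pi pi) (W := [set 0])).
  by split=> // c u v /= -> ->; rewrite scaler0 addr0.
move=> _ [a [b [[Ia|Ib] ->]]]; rewrite /= tmapE /=.
  by rewrite (ideal_api0 S1 Ia) tens0l.
by rewrite (ideal_api0 S1 Ib) tens0r.
Qed.

Fact counit_ideal x : ideal S x -> counit_lin x = 0.
Proof. by have [_ _ _ he _] := HI; apply: he. Qed.

Fact antipode_ideal x : ideal S x -> (pi \o antipode H) x = 0.
Proof.
have [_ _ _ _ hS] := HI => Ix; rewrite /=.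
by apply: ideal_api0; apply: hS.
Qed.

Definition quotient_hopf : hopf Q :=
  @hopf_of_quotient_maps (aquot_lift S1 comul_ideal)
    (scalar_of (f := aquot_lift S1 counit_ideal : Q -> R)
      (fun c u v => linearP (aquot_lift S1 counit_ideal) c u v))
    (aquot_lift S1 antipode_ideal) (aquot_liftE S1 comul_ideal)
    (aquot_liftE S1 counit_ideal) (aquot_liftE S1 antipode_ideal).

Lemma api_hopf_morphism : hopf_morphism H quotient_hopf pi.
Proof.
split=> [c u v||x|x|x]; first by rewrite linearP.
- by split=> [|u v]; [exact: (rmorph1 pi)|exact: apiM].
- exact: (aquot_liftE S1 comul_ideal).
- exact: (aquot_liftE S1 counit_ideal).
- exact: (aquot_liftE S1 antipode_ideal).
Qed.

End QuotientHopf.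

Section IdealMaps.
Variables (R : comNzRingType) (A : algType R) (S : set A).

(** The product on the target is an arbitrary bilinear operation, so that the
    statement covers both the comultiplication and the antipode, which is
    multiplicative for the opposite product. *)
Lemma multiplicative_ideal_kernel (V : lmodType R) (mul : V -> V -> V)
    (f : {linear A -> V}) :
  (forall v, linear (mul^~ v)) -> (forall u, linear (mul u)) ->
  (forall x y, f (x * y) = mul (f x) (f y)) ->
  (forall s, S s -> f s = 0) -> forall x, ideal S x -> f x = 0.
Proof.
move=> mulL mulR fM fS x.
apply: (linspan_image (f := f) (W := [set 0])).
  by split=> // c u v /= -> ->; rewrite scaler0 addr0.
move=> _ [a [s [b [Ss ->]]]] /=; rewrite !fM (fS _ Ss).
have -> : mul (f a) 0 = 0 by exact: (linear0 (linear_of (mulR (f a)))).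
exact: (linear0 (linear_of (mulL (f b)))).
Qed.

Variable H : hopf A.
Hypothesis antipodeM : forall x y, antipode H (x * y) = antipode H y * antipode H x.

Let J : set (tensor A A) :=
  linspan [set t | exists a b, (ideal S a \/ ideal S b) /\ t = tens a b].

Let J_sub : is_subspace J.
Proof. exact: linspan_subspace. Qed.

Let J_mul u t v : J t -> J (u * t * v).
Proof.
move=> Jt; move: u; apply: tensor_ind => [a b|c u u' Hu Hu']; last first.
  by rewrite !tensor_mulPl; apply: J_sub.2.
move: v; apply: tensor_ind => [a' b'|c v v' Hv Hv']; last first.
  by rewrite tensor_mulPr; apply: J_sub.2.
have fL : linear (fun t : tensor A A => tens a b * t * tens a' b').
  by move=> c u v; rewrite tensor_mulPr tensor_mulPl.
move: Jt; apply: (linspan_image (f := linear_of fL)) => // _ [x [y [hxy ->]]] /=.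
rewrite !tensM; apply: linspan_gen; exists (a * x * a'), (b * y * b'); split=> //.
by case: hxy => h; [left|right]; apply: ideal_mulr; apply: ideal_mull.
Qed.

(** I (x) A + A (x) I is a two-sided ideal of A (x) A, so it contains the image
    of I under the comultiplication once it contains the images of generators. *)
Lemma hopf_ideal_of_generators :
  (forall s, S s -> J (comul H s)) -> (forall s, S s -> counit H s = 0) ->
  (forall s, S s -> ideal S (antipode H s)) -> hopf_ideal H (ideal S).
Proof.
move=> DS eS aS; have hI := linspan_subspace (ideal_gens S).
split=> //.
- by move=> a x b Ix; apply: ideal_mulr; apply: ideal_mull.
- move=> x; apply: (linspan_image (f := comul H)) => // _ [a [s [b [Ss ->]]]].
  by rewrite !(comul_monoid H).2; apply: J_mul; apply: DS.
- apply: (@linspan_ind _ _ _ [set x | counit H x = 0]).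
    by split=> [|c u v /= hu hv] /=; rewrite ?linear0 ?linearP ?hu ?hv ?mulr0 ?addr0.
  move=> _ [a [s [b [Ss ->]]]] /=.
  by rewrite !(counit_monoid H).2 (eS _ Ss) mulr0 mul0r.
- move=> x; apply: (linspan_image (f := antipode H)) => // _ [a [s [b [Ss ->]]]].
  by rewrite !antipodeM mulrA; apply: ideal_mulr; apply: ideal_mull; apply: aS.
Qed.

End IdealMaps.

(** * Maps out of an algebra given by generators and relations *)

Section FreeAlgebra.
Variables (R : comNzRingType) (X : choiceType).
Local Notation F := (freealg R X).
Local Notation gen := (@fgen R X).

Let word (w : {fmonom X}) : F := << w >>.

Let word1 : word (mone : {fmonom X}) = 1.
Proof. by rewrite -[1]/(freealg_one R X) freealg_one.unlock. Qed.

Let word_gen g w : gen g * word w = word (mmul (fmu g) w).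
Proof. by rewrite fgen.unlock freealgM [LHS]fgmulUU mulr1. Qed.

Let word_expand (x : F) : x = \sum_(w <- msupp x) x@_w *: word w.
Proof.
rewrite {1}[x]monalgE; apply: eq_bigr => w _.
by apply/malgP => v; rewrite mcoeffZ !mcoeffU mulr_natr.
Qed.

Let word_ext (V : lmodType R) (f h : {linear F -> V}) :
  (forall w, f (word w) = h (word w)) -> f =1 h.
Proof.
move=> fh x; rewrite (word_expand x) !linear_sum; apply: eq_bigr => w _.
by rewrite !linearZ fh.
Qed.

(** Induction on words, read from the left. *)
Lemma freealg_ind (P : set F) : is_subspace P -> P 1 ->
  (forall g x, P x -> P (gen g * x)) -> forall x, P x.
Proof.
move=> hP P1 Pg x; rewrite (word_expand x); apply: subspace_sum => // w _.
apply: subspaceZ => //; case: w => s.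
elim: s => [|g s IH]; first by move: P1; rewrite -word1 [mone]fmoneE.
have -> : FMonom (g :: s) = mmul (fmu g) (FMonom s).
  by apply: val_inj; rewrite /= fmM fmU.
by rewrite -word_gen; apply: Pg.
Qed.

Section Eval.
Variables (V : lmodType R) (mul : V -> V -> V) (one : V) (a : X -> V).

(** The target is a module with a bilinear operation rather than an algebra:
    A (x) A is only a ring, and an antihomomorphism is a homomorphism for the
    opposite operation. *)
Definition word_eval (w : {fmonom X}) : V := foldr (fun g => mul (a g)) one (w : seq X).

Definition free_eval (x : F) : V := \sum_(w <- msupp x) x@_w *: word_eval w.

Lemma free_evalw (d : {fset {fmonom X}}) (x : F) :
  (msupp x `<=` d)%fset -> free_eval x = \sum_(w <- d) x@_w *: word_eval w.
Proof.
move=> le; rewrite [LHS](big_fset_incl _ le) => //= w wd /mcoeff_outdom ->.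
by rewrite scale0r.
Qed.

Fact free_eval_linear : linear free_eval.
Proof.
move=> c u v.
pose d := (msupp (c *: u + v)%R `|` (msupp u `|` msupp v))%fset.
rewrite (@free_evalw d) ?fsubsetUl // (@free_evalw d u) ?(@free_evalw d v).
- rewrite scaler_sumr -big_split /=; apply: eq_bigr => p _.
  by rewrite mcoeffD mcoeffZ scalerDl scalerA.
- exact: fsubset_trans (fsubsetUr _ _) (fsubsetUr _ _).
- exact: fsubset_trans (fsubsetUl _ _) (fsubsetUr _ _).
Qed.

Definition free_eval_lin : {linear F -> V} := linear_of free_eval_linear.

Hypotheses (mulL : forall v, linear (mul^~ v)) (mulR : forall u, linear (mul u)).
Hypotheses (opA : associative mul) (op1l : left_id one mul) (op1r : right_id one mul).

Let free_eval_word w : free_eval_lin (word w) = word_eval w.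
Proof. by rewrite /= (free_evalw msuppU_le) big_seq_fset1 mcoeffUU scale1r. Qed.

Lemma free_eval1 : free_eval_lin 1 = one.
Proof. by rewrite -word1 free_eval_word /word_eval fm1. Qed.

Let mul_lin u : {linear V -> V} := linear_of (mulR u).

Lemma free_eval_genM g x : free_eval_lin (gen g * x) = mul (a g) (free_eval_lin x).
Proof.
apply: (@word_ext V (free_eval_lin \o (gen g \*o idfun))
  (mul_lin (a g) \o free_eval_lin)) => w.
rewrite -[LHS]/(free_eval_lin (gen g * word w)).
rewrite -[RHS]/(mul (a g) (free_eval_lin (word w))).
by rewrite word_gen !free_eval_word /word_eval fmM fmU.
Qed.

Lemma free_eval_gen g : free_eval_lin (gen g) = a g.
Proof. by rewrite -[gen g]mulr1 free_eval_genM free_eval1 op1r. Qed.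

Lemma free_evalM x y : free_eval_lin (x * y) = mul (free_eval_lin x) (free_eval_lin y).
Proof.
move: x; apply: freealg_ind => [||g x IH].
- exact: (equalizer_subspace (free_eval_lin \o (y \o* idfun))
            (linear_of (mulL (free_eval_lin y)) \o free_eval_lin)).
- by rewrite mul1r free_eval1 op1l.
- by rewrite -mulrA !free_eval_genM IH opA.
Qed.

End Eval.
End FreeAlgebra.

Lemma generates_quot (R : comNzRingType) (A : algType R) (S G : set A)
    (S1 : ~ ideal S 1) : generates G ->
  generates [set x | exists2 g, G g & x = api S1 g].
Proof.
move=> genG P hP P1 Pg x; elim/api_ind: x => x.
apply: (genG [set x | P (api S1 x)]).
- exact: preimage_subspace.
- by rewrite /= rmorph1.
- by move=> g y Gg Py /=; rewrite apiM; apply: Pg => //; exists g.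
Qed.

(** * Finite-dimensional spaces and pointed Hopf algebras *)

Section FiniteSpan.
Variable k : fieldType.

Lemma linspan_seq_cons (V : lmodType k) (g : V) (s : seq V) x :
  linspan [set y | y \in g :: s] x ->
  exists c y, x = c *: g + y /\ linspan [set y | y \in s] y.
Proof.
have [h0 hL] := linspan_subspace [set y | y \in s].
apply: (@linspan_ind _ _ _
  [set x | exists c y, x = c *: g + y /\ linspan [set y | y \in s] y]).
  split=> [|c _ _ [a [y [-> hy]]] [b [z [-> hz]]]] /=.
    by exists 0, 0; rewrite scale0r addr0.
  exists (c * a + b), (c *: y + z); split; last exact: hL.
  by rewrite scalerDr scalerDl scalerA addrACA.
move=> y /=; rewrite in_cons => /orP[/eqP ->|ys].
  by exists 1, 0; rewrite scale1r addr0.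
by exists 0, y; rewrite scale0r add0r; split => //; apply: linspan_gen.
Qed.

Lemma linspan_finite (V : lmodType k) (S : set V) x : linspan S x ->
  exists2 s : seq V, (forall y, y \in s -> S y) & linspan [set y | y \in s] x.
Proof.
apply: (@linspan_ind _ _ _ [set x | exists2 s : seq V, (forall y, y \in s -> S y)
  & linspan [set y | y \in s] x]); last first.
  move=> y Sy; exists [:: y]; first by move=> z /[!inE] /eqP ->.
  by apply: linspan_gen; rewrite /= mem_head.
split=> [|c u v [s sS su] [t tS tv]] /=.
  by exists [::] => //; apply: (linspan_subspace _).1.
exists (s ++ t); first by move=> y; rewrite mem_cat => /orP[/sS|/tS].
apply: (linspan_subspace _).2.
  by apply: linspanS su => y /= ys; rewrite mem_cat ys.
by apply: linspanS tv => y /= yt; rewrite mem_cat yt orbT.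
Qed.

(** If the vectors of s are independent then their coordinates are the
    isomorphism; otherwise a nontrivial relation allows one to drop a vector and
    to conclude by induction on the length. *)
Lemma finite_span_iso (V : lmodType k) (s : seq V) :
  (forall v, linspan [set x | x \in s] v) ->
  exists d (f : {linear V -> 'rV[k]_d}), bijective f.
Proof.
have [d] := ubnP (size s); elim: d s => // d IH s sd sV.
pose comb (c : 'rV[k]_(size s)) : V := \sum_i c 0 i *: s`_i.
have combL : linear comb.
  move=> a u v; rewrite /comb scaler_sumr -big_split; apply: eq_bigr => i _ /=.
  by rewrite !mxE scalerDl scalerA.
pose cl := linear_of combL.
have surj v : exists c, comb c = v.
  suff hs : is_subspace [set v | exists c, cl c = v].
    apply: (linspan_ind hs) (sV v) => x /= xs.
    pose i : 'I_(size s) := Ordinal (etrans (index_mem x s) xs).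
    exists (delta_mx 0 i); rewrite /= /comb (bigD1 i) //= big1 => [|j ji].
      by rewrite mxE !eqxx scale1r addr0 nth_index.
    by rewrite mxE eqxx (negbTE ji) scale0r.
  split=> [|a _ _ [c <-] [c' <-]] /=; first by exists 0; apply: (linear0 cl).
  by exists (a *: c + c'); apply: (linearP cl).
have [inj|] := pselect (forall c, comb c = 0 -> c = 0).
  have [g gK] := choice surj.
  have cK : cancel comb g.
    move=> c; apply/eqP; rewrite -subr_eq0; apply/eqP/inj.
    by rewrite -[LHS]/(cl _) raddfB /= gK subrr.
  have gL : linear g.
    by move=> a u v; rewrite -[RHS]cK combL !gK.
  by exists (size s), (linear_of gL); exists comb.
move/existsNP => [c /not_implyP [c0 /eqP /rV0Pn [i ci]]].
(* c is a relation with c_i != 0, so the i-th vector is redundant. *)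
pose s' := [seq s`_j | j : 'I_(size s) in predC1 i].
apply: (IH s').
  by rewrite size_image cardC1 card_ord -ltnS prednK // (leq_ltn_trans _ (ltn_ord i)).
have hL := linspan_subspace [set x | x \in s'].
have hs' (j : 'I_(size s)) : j != i -> linspan [set x | x \in s'] s`_j.
  by move=> ji; apply: linspan_gen; rewrite /= /s'; apply/mapP; exists j; rewrite ?mem_enum.
move=> v; apply: linspan_ind (sV v) => // x /= xs.
pose j : 'I_(size s) := Ordinal (etrans (index_mem x s) xs).
have <- : s`_j = x by rewrite nth_index.
have [->|/hs' //] := eqVneq j i.
have -> : s`_i = - (c 0 i)^-1 *: \sum_(l | l != i) c 0 l *: s`_l.
  move: c0; rewrite /comb (bigD1 i) //= => /eqP; rewrite addr_eq0 => /eqP.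
  rewrite scaleNr => /(congr1 (fun v => (c 0 i)^-1 *: v)).
  by rewrite scalerA mulVf // scale1r scalerN => ->.
apply: (subspaceZ _ hL); apply: (subspace_sum _ hL) => l li.
by apply: (subspaceZ _ hL); apply: hs'.
Qed.

(** The quotient V / W is again finitely spanned, so it is isomorphic to a space
    of row vectors, and some coordinate of the class of v is nonzero. *)
Lemma separating_functional (V : lmodType k) (s : seq V) (W : set V) v :
  (forall v, linspan [set x | x \in s] v) -> is_subspace W -> ~ W v ->
  exists2 f : {scalar V}, (forall w, W w -> f w = 0) & f v != 0.
Proof.
move=> sV hW Wv.
have [|d [g [h gK hK]]] := @finite_span_iso (lquot W) [seq lpi W x | x <- s].
  elim/lpi_ind => x.
  apply: (linspan_image (f := @lpi _ _ W)) (sV x); first exact: linspan_subspace.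
  by move=> y /= ys; apply: linspan_gen; apply/mapP; exists y.
have /rV0Pn [i hi] : g (lpi W v) != 0.
  apply/eqP => gv; apply: Wv; apply: (linspan_ind hW (S := W)) => //.
  have := can_inj gK; rewrite -(raddf0 g) in gv => /(_ _ _ gv).
  by rewrite -(raddf0 (lpi W)) => /lpiP; rewrite subr0.
have fL : scalar (fun x => g (lpi W x) 0 i).
  by move=> c x y /=; rewrite !linearP !mxE.
exists (scalar_of fL) => //= w Ww.
have -> : lpi W w = 0.
  by rewrite -(raddf0 (lpi W)); apply/lpiP; rewrite subr0; apply: linspan_gen.
by rewrite raddf0 mxE.
Qed.

End FiniteSpan.

Section GroupLike.
Variables (R : comNzRingType) (A : algType R) (H : hopf A).

Lemma group_like1 : group_like H 1.
Proof. by rewrite /group_like (comul_monoid H).1 (counit_monoid H).1. Qed.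

Lemma group_likeM g h : group_like H g -> group_like H h -> group_like H (g * h).
Proof.
move=> [Dg eg] [Dh eh]; split; last by rewrite (counit_monoid H).2 eg eh mulr1.
by rewrite (comul_monoid H).2 Dg Dh tensM.
Qed.

Definition skew_primitive (p : A) : Prop :=
  exists g h, [/\ group_like H g, group_like H h
    & comul H p = tens p g + tens h p].

End GroupLike.

Section GroupLikeMorphism.
Variables (R : comNzRingType) (A B : algType R) (HA : hopf A) (HB : hopf B).
Variable f : {linear A -> B}.
Hypothesis fH : hopf_morphism HA HB f.

Lemma morphism_group_like g : group_like HA g -> group_like HB (f g).
Proof.
have [_ _ fD fe _] := fH; move=> [Dg eg].
by split; rewrite ?fe // fD Dg tmapE.
Qed.

Lemma morphism_skew_primitive p : skew_primitive HA p -> skew_primitive HB (f p).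
Proof.
have [_ _ fD _ _] := fH; move=> [g [h [Gg Gh Dp]]].
exists (f g), (f h); split; try exact: morphism_group_like.
by rewrite fD Dp tmapD !tmapE.
Qed.

End GroupLikeMorphism.

Section PointedCriterion.
Variables (k : fieldType) (A : algType k) (H : hopf A) (s : seq A).
Hypothesis sA : forall v, linspan [set x | x \in s] v.
Hypothesis genA : generates [set x | group_like H x \/ skew_primitive H x].

(** These are the maps id (x) f and f (x) id. *)
Let slicer (f : {scalar A}) : {linear tensor A A -> A} :=
  tlift_lin (counitr_bilinear f).
Let slicel (f : {scalar A}) : {linear tensor A A -> A} :=
  tlift_lin (counitl_bilinear f).

Let slicerE f a b : slicer f (tens a b) = f b *: a.
Proof. exact: tliftE (counitr_bilinear f) _ _. Qed.

Let slicelE f a b : slicel f (tens a b) = f a *: b.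
Proof. exact: tliftE (counitl_bilinear f) _ _. Qed.

Let slicer_tensM f a b t :
  slicer f (tens a b * t) = a * slicer (f \o (b \*o idfun)) t.
Proof.
move: t; apply: tensor_ind => [c d|c x y Hx Hy].
  by rewrite tensM !slicerE scalerAr.
by rewrite tensor_mulPr !linearP Hx Hy mulrDr scalerAr.
Qed.

(** A subcoalgebra is stable under both kinds of slices of the coproduct; this is
    how elements of smaller degree are found inside it. *)
Lemma subcoalgebra_slicer C f x : subcoalgebra H C -> C x -> C (slicer f (comul H x)).
Proof.
move=> [hC DC] /DC; apply: linspan_image => // _ [a [b [Ca Cb ->]]].
by rewrite slicerE; apply: subspaceZ.
Qed.

Lemma subcoalgebra_slicel C f x : subcoalgebra H C -> C x -> C (slicel f (comul H x)).
Proof.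
move=> [hC DC] /DC; apply: linspan_image => // _ [a [b [Ca Cb ->]]].
by rewrite slicelE; apply: subspaceZ.
Qed.

(** The degree bounds the number of skew-primitive factors; the spans [filt n] form
    a filtration whose bottom is spanned by group-likes. *)
Inductive skew_word : nat -> A -> Prop :=
| SkewWord0 g : group_like H g -> skew_word 0 g
| SkewWordG n g w : group_like H g -> skew_word n w -> skew_word n (g * w)
| SkewWordP n p w : skew_primitive H p -> skew_word n w -> skew_word n.+1 (p * w)
| SkewWordS n w : skew_word n w -> skew_word n.+1 w.

Definition filt n : set A := linspan (skew_word n).

Let filt_sub n : is_subspace (filt n).
Proof. exact: linspan_subspace. Qed.

Lemma skew_word0 w : skew_word 0 w -> group_like H w.
Proof.
move e: 0%N => n hw; elim: hw e => {n w} // n g w Gg _ IH /IH.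
exact: group_likeM.
Qed.

Lemma filtS n : filt n `<=` filt n.+1.
Proof. by apply: linspanS => w; apply: SkewWordS. Qed.

Lemma filt_le n m : (n <= m)%N -> filt n `<=` filt m.
Proof.
move=> /subnKC <-; elim: (m - n)%N => [|i IH] x; first by rewrite addn0.
by rewrite addnS => /IH /filtS.
Qed.

Lemma filtG n g x : group_like H g -> filt n x -> filt n (g * x).
Proof.
move=> Gg; apply: (linspan_image (f := g \*o idfun)) => // w hw.
by apply: linspan_gen; apply: SkewWordG.
Qed.

Lemma filtP n p x : skew_primitive H p -> filt n x -> filt n.+1 (p * x).
Proof.
move=> hp; apply: (linspan_image (f := p \*o idfun)) => // w hw.
by apply: linspan_gen; apply: SkewWordP.
Qed.

Lemma filt_exhaustive x : exists n, filt n x.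
Proof.
move: x; apply: genA.
- split=> [|c u v [n hu] [m hv]]; first by exists 0%N; apply: (filt_sub 0).1.
  exists (maxn n m); apply: (filt_sub _).2.
    exact: filt_le (leq_maxl _ _) _ hu.
  exact: filt_le (leq_maxr _ _) _ hv.
- by exists 0%N; apply: linspan_gen; apply: SkewWord0; apply: group_like1.
move=> g x [Gg|Gp] [n hx]; first by exists n; apply: filtG.
by exists n.+1; apply: filtP.
Qed.

(** Slicing by a functional that kills the group-likes lowers the degree by one;
    setting the value to 0 in degree 0 makes this uniform. *)
Let below n : set A := if n is m.+1 then filt m else [set 0].

Let below_sub n : is_subspace (below n).
Proof.
by case: n => // ; split=> // c u v /= -> ->; rewrite scaler0 addr0.
Qed.

Let below_filt n : below n `<=` filt n.
Proof. by case: n => [|n] x /=; [move->; apply: (filt_sub 0).1|apply: filtS]. Qed.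

Let belowG n g x : group_like H g -> below n x -> below n (g * x).
Proof. by case: n => [|n] Gg /=; [move->; rewrite mulr0|apply: filtG]. Qed.

Let belowP n p x : skew_primitive H p -> below n x -> filt n (p * x).
Proof.
case: n => [|n] hp /=; last exact: filtP.
by move->; rewrite mulr0; apply: (filt_sub 0).1.
Qed.

(** Multiplying a word by a skew-primitive p adds the terms p (x) g and h (x) p.
    The first raises the degree on the left but keeps the right slot up to a
    group-like, so that the functional still kills the group-likes there; the
    second keeps the degree on the left. Arbitrary functionals are needed in the
    induction because of the second term. *)
Lemma slicer_skew_word n w : skew_word n w ->
  (forall f : {scalar A}, filt n (slicer f (comul H w))) /\
  (forall f : {scalar A}, (forall g, group_like H g -> f g = 0) ->
     below n (slicer f (comul H w))).
Proof.
elim=> {n w} [g Gg|n g w Gg _ [IHf IHb]|n p w [g [h [Gg Gh Dp]]] _ [IHf IHb]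
             |n w _ [IHf IHb]].
- rewrite Gg.1; split=> f; rewrite slicerE.
    by apply: (subspaceZ _ (filt_sub 0)); apply: linspan_gen; apply: SkewWord0.
  by move=> /(_ _ Gg) ->; rewrite scale0r.
- rewrite (comul_monoid H).2 Gg.1; split=> f; rewrite slicer_tensM.
    exact: filtG.
  by move=> f0; apply: belowG => //; apply: IHb => x Gx; apply: f0; apply: group_likeM.
- rewrite (comul_monoid H).2 Dp mulrDl.
  have hp : skew_primitive H p by exists g, h.
  split=> f; rewrite linearD !slicer_tensM.
    apply: (subspaceD (filt_sub _)); first exact: filtP.
    by apply: filtS; apply: filtG.
  move=> f0; apply: (subspaceD (below_sub _)); last exact: filtG.
  by apply: belowP => //; apply: IHb => x Gx; apply: f0; apply: group_likeM.
split=> f; first by apply: filtS; apply: IHf.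
by move=> f0; apply: below_filt; apply: IHb.
Qed.

Lemma slicer_filt n x (f : {scalar A}) : (forall g, group_like H g -> f g = 0) ->
  filt n x -> below n (slicer f (comul H x)).
Proof.
move=> f0; apply: (linspan_image (f := slicer f \o comul H)) => // w hw.
exact: (slicer_skew_word hw).2.
Qed.

(** If x is not in the bottom of the filtration, some functional f kills the
    bottom and not x. The slice of the coproduct of x by f stays in D and has
    smaller degree, and it is nonzero because its counit is f x. *)
Lemma subcoalgebra_bottom D n x : subcoalgebra H D -> D x -> x != 0 -> filt n x ->
  exists y, [/\ D y, y != 0 & filt 0 y].
Proof.
move=> hD; elim: n x => [|n IH] x Dx x0 fx; first by exists x.
have [|f0x] := pselect (filt 0 x); first by exists x.
have [f fG fx0] := separating_functional sA (filt_sub 0) f0x.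
apply: (IH (slicer f (comul H x))); first exact: subcoalgebra_slicer.
  apply/eqP => sx0; move: fx0; apply/negP; rewrite negbK.
  (* f x is the counit of the slice, by the counit axiom. *)
  have := comul_counitl H x => /(congr1 f).
  suff -> t : f (tlift (fun a b => counit H a *: b) t) = counit H (slicer f t).
    by rewrite sx0 linear0 => <-.
  move: t; apply: tensor_ind => [a b|c u v Hu Hv].
    by rewrite slicerE (tliftE (counitl_bilinear (counit H))) !linearZ /= mulrC.
  by rewrite (tlift_linear (counitl_bilinear (counit H))) !linearP Hu Hv.
apply: (@slicer_filt n.+1) fx => g Gg; apply: fG.
by apply: linspan_gen; apply: SkewWord0.
Qed.

(** For a shortest expression of x as a combination of group-likes, its first
    group-like g is independent of the others, so the slice of the coproduct of x
    by a functional dual to g is a nonzero multiple of g. *)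
Lemma subcoalgebra_group_like D (gs : seq A) x : subcoalgebra H D ->
  (forall g, g \in gs -> group_like H g) -> linspan [set g | g \in gs] x ->
  D x -> x != 0 -> exists2 g, group_like H g & D g.
Proof.
move=> hD; elim: gs x => [|g gs IH] x Ggs xs Dx x0.
  case/negP: x0; apply/eqP; apply: (linspan_ind (P := [set 0])) xs => //.
  by split=> // c u v /= -> ->; rewrite scaler0 addr0.
have Ggs' h : h \in gs -> group_like H h.
  by move=> hh; apply: Ggs; rewrite in_cons hh orbT.
have [c [y [xE ys]]] := linspan_seq_cons xs.
have hs := linspan_subspace [set g | g \in gs].
have [gin|gout] := pselect (linspan [set g | g \in gs] g).
  by apply: (IH x) => //; rewrite xE; apply: hs.2.
have [c0|c0] := eqVneq c 0.
  by apply: (IH x) => //; rewrite xE c0 scale0r add0r.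
have Gg : group_like H g by apply: Ggs; rewrite mem_head.
exists g => //.
have [f fgs fg] := separating_functional sA hs gout.
have sy : slicel f (comul H y) = 0.
  apply: (linspan_image (f := slicel f \o comul H) (W := [set 0])) ys.
    by split=> // d u v /= -> ->; rewrite scaler0 addr0.
  move=> h /= hh; rewrite (Ggs' _ hh).1 -[tlift _ _]/(slicel f _) slicelE.
  by rewrite fgs ?scale0r //; apply: linspan_gen.
have := subcoalgebra_slicel f hD Dx.
rewrite xE !linearP sy addr0 Gg.1 slicelE scalerA => Dg.
have cf : c * f g != 0 by rewrite mulf_neq0.
have := subspaceZ (c * f g)^-1 hD.1 Dg.
by rewrite scalerA mulVf // scale1r.
Qed.

Lemma line_subcoalgebra g : group_like H g ->
  subcoalgebra H [set z *: g | z in [set: k]].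
Proof.
move=> Gg; split.
  split; first by exists 0; rewrite ?scale0r.
  move=> c _ _ [a _ <-] [b _ <-]; exists (c * a + b) => //.
  by rewrite scalerDl scalerA.
move=> _ [z _ <-]; rewrite linearZ /= Gg.1.
apply: (subspaceZ _ (linspan_subspace _)).
by apply: linspan_gen; exists g, g; split=> //; exists 1; rewrite ?scale1r.
Qed.

(** A simple subcoalgebra contains a group-like by [subcoalgebra_bottom] and
    [subcoalgebra_group_like], hence the line that it spans, which is already a
    subcoalgebra. *)
Theorem pointed_of_skew_generated : pointed H.
Proof.
move=> C [hC C0 Cmin].
have [x [Cx x0]] : exists x, C x /\ x != 0.
  apply: contrapT => /forallNP hx; apply: C0.
  apply/seteqP; split=> [x Cx|_ ->] /=; last exact: hC.1.1.
  by apply: contrapT => /eqP x0; apply: (hx x).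
have [n fx] := filt_exhaustive x.
have [y [Cy y0 /linspan_finite [gs Ggs ygs]]] := subcoalgebra_bottom hC Cx x0 fx.
have Ggs' g : g \in gs -> group_like H g by move/Ggs/skew_word0.
have [g Gg Cg] := subcoalgebra_group_like hC Ggs' ygs Cy y0.
have g0 : g != 0.
  by apply/eqP => g0; have := Gg.2; rewrite g0 linear0 => /eqP; rewrite eq_sym oner_eq0.
exists g => //.
have sub : [set z *: g | z in [set: k]] `<=` C.
  by move=> _ [z _ <-]; apply: subspaceZ hC.1 Cg.
have [e|e] := Cmin _ (line_subcoalgebra Gg) sub; last by rewrite -e.
have : [set z *: g | z in [set: k]] g by exists 1; rewrite ?scale1r.
by rewrite e => /= g0'; rewrite g0' eqxx in g0.
Qed.

End PointedCriterion.

(** * Elements commuting up to scalars *)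

Section QCommuting.
Variables (k : fieldType) (A : algType k).

Lemma qcommX (x y : A) c n : x * y = c *: (y * x) -> x * y ^+ n = c ^+ n *: (y ^+ n * x).
Proof.
move=> xy; elim: n => [|n IH]; first by rewrite !expr0 scale1r mulr1 mul1r.
by rewrite [in LHS]exprS mulrA xy -scalerAl -(mulrA y) IH -scalerAr scalerA mulrA -!exprS.
Qed.

Lemma qcommXl (x y : A) c n : x * y = c *: (y * x) -> x ^+ n * y = c ^+ n *: (y * x ^+ n).
Proof.
move=> xy; elim: n => [|n IH]; first by rewrite !expr0 scale1r mulr1 mul1r.
by rewrite [in LHS]exprSr -mulrA xy -scalerAr mulrA IH -scalerAl scalerA -(mulrA y) -exprSr -exprS.
Qed.

(** The ordered monomials in xs with bounded exponents span everything: a factor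
    multiplied from the left can be moved to its own place at the cost of a
    scalar, and there its exponent is reduced by x ^+ e = 0 or 1. *)
Lemma qcommuting_finite_span (G : set A) (xs : seq A) : generates G ->
  (forall x y, x \in xs -> y \in xs -> exists c, x * y = c *: (y * x)) ->
  (forall x, x \in xs -> exists2 e, (0 < e)%N & x ^+ e = 0 \/ x ^+ e = 1) ->
  (forall g, G g -> exists x a, x \in xs /\ g = x ^+ a) ->
  exists s : seq A, forall v, linspan [set x | x \in s] v.
Proof.
move=> genG xsC xsN Gxs.
suff [s [s1 sM]] : exists s : seq A, linspan [set x | x \in s] 1 /\
    forall x v, x \in xs -> linspan [set x | x \in s] v ->
      linspan [set x | x \in s] (x * v).
  exists s; apply: genG => //; first exact: linspan_subspace.
  move=> g v /Gxs [x [a [hx ->]]]; elim: a v => [|a IH] v hv; first by rewrite mul1r.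
  by rewrite exprS -mulrA; apply: sM => //; apply: IH.
elim: xs xsC xsN {Gxs} => [|x xs IH] xsC xsN.
  by exists [:: 1]; split=> //; apply: linspan_gen; rewrite /= mem_head.
have sub y : y \in xs -> y \in x :: xs by rewrite in_cons orbC => ->.
have [s [s1 sM]] := IH (fun y z hy hz => xsC y z (sub y hy) (sub z hz))
  (fun y hy => xsN y (sub y hy)).
have [e e0 xe] := xsN x (mem_head _ _).
pose t := [seq x ^+ a * w | a <- iota 0 e, w <- s].
have ht := linspan_subspace [set y | y \in t].
have st a v : (a < e)%N -> linspan [set y | y \in s] v ->
    linspan [set y | y \in t] (x ^+ a * v).
  move=> ae; apply: (linspan_image (f := x ^+ a \*o idfun)) => // w ws.
  by apply: linspan_gen; apply/allpairsP; exists (a, w); rewrite /= mem_iota add0n.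
exists t; split; first by rewrite -[1]mulr1; apply: (st 0%N).
move=> y v hy; apply: (linspan_image (f := y \*o idfun)) => // w.
move=> /allpairsP [[a u] /= [/[!mem_iota] /andP[_ /[!add0n] ae] us ->]].
have su : linspan [set y | y \in s] u by apply: linspan_gen.
move: hy; rewrite in_cons => /orP[/eqP ->|hy].
  rewrite mulrA -exprS; move: ae; rewrite leq_eqVlt => /orP[/eqP ->|ae]; last exact: st.
  case: xe => ->; first by rewrite mul0r; apply: ht.1.
  by rewrite -(expr0 x); apply: st.
have [c yx] := xsC y x (sub y hy) (mem_head _ _).
rewrite mulrA (qcommX _ yx) -scalerAl -mulrA.
by apply: (subspaceZ _ ht); apply: st => //; apply: sM.
Qed.

End QCommuting.

Section QBinomial.
Variables (k : fieldType) (z : k).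

(** The Gaussian binomial coefficient, by its Pascal recursion, which makes sense
    also when z is a root of unity. *)
Fixpoint qbin (n i : nat) : k :=
  match n, i with
  | _, 0%N => 1
  | 0%N, _.+1 => 0
  | n.+1, i.+1 => qbin n i + z ^+ i.+1 * qbin n i.+1
  end.

Lemma qbin0 n : qbin n 0 = 1. Proof. by case: n. Qed.

Lemma qbin_small n i : (n < i)%N -> qbin n i = 0.
Proof.
elim: n i => [|n IH] [|i] //= ni.
by rewrite !IH ?mulr0 ?addr0 // ltnW.
Qed.

Lemma qbinn n : qbin n n = 1.
Proof. by elim: n => //= n ->; rewrite qbin_small // mulr0 addr0. Qed.

(** The quotient-free form of [n choose i+1] / [n choose i] = [n-i] / [i+1]. *)
Lemma qbin_ratio n i : (i <= n)%N ->
  (1 - z ^+ i.+1) * qbin n i.+1 = (1 - z ^+ (n - i)) * qbin n i.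
Proof.
elim: n i => [|n IH] [|i] // ni; first by rewrite expr0 subrr mul0r mulr0.
  rewrite subn0 qbin0 mulr1 /= qbin0 mulrDr mulr1 mulrCA IH // qbin0 mulr1 subn0.
  by rewrite expr1 mulrBr mulr1 -exprS; ring.
have hE (j : nat) : (j <= n)%N ->
    (1 - z ^+ j.+1) * qbin n.+1 j.+1 = (1 - z ^+ n.+1) * qbin n j.
  move=> jn; rewrite /= mulrDr mulrCA IH //.
  have -> : z ^+ n.+1 = z ^+ j.+1 * z ^+ (n - j) by rewrite -exprD addSn subnKC.
  by ring.
have [-> | ] := eqVneq i n.
  by rewrite subnn expr0 subrr mul0r /= !(@qbin_small n) ?mulr0 ?addr0 ?mulr0.
move: ni; rewrite ltnS leq_eqVlt => /orP[/eqP -> /eqP //|ni _].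
rewrite (hE i.+1) // subSS /= mulrDr -(IH i) ?(ltnW ni) //.
have -> : z ^+ n.+1 = z ^+ i.+1 * z ^+ (n - i) by rewrite -exprD addSn subnKC ?(ltnW ni).
by ring.
Qed.

(** By [qbin_ratio], (1 - z^i) times this coefficient is a multiple of 1 - z^l. *)
Lemma qbin_root l i : z ^+ l = 1 -> (forall j, (0 < j < l)%N -> z ^+ j != 1) ->
  (0 < i < l)%N -> qbin l i = 0.
Proof.
case: l i => [|l] [|i] // zl zj il.
have il' : (i <= l)%N by apply: ltnW; case/andP: il.
have h := qbin_ratio il'.
have : (1 - z ^+ i.+1) * qbin l.+1 i.+1 = 0.
  rewrite /= mulrDr mulrCA h.
  have -> : (1 - z ^+ i.+1) * qbin l i + z ^+ i.+1 * ((1 - z ^+ (l - i)) * qbin l i)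
      = (1 - z ^+ i.+1 * z ^+ (l - i)) * qbin l i by ring.
  by rewrite -exprD addSn subnKC // zl subrr mul0r.
move/eqP; rewrite mulf_eq0 subr_eq0 eq_sym => /orP[|/eqP //].
by rewrite (negbTE (zj _ il)).
Qed.

Variables A B : algType k.
Implicit Types x y : tensor A B.

Let mulZl (c : k) x y : c *: (x * y) = (c *: x) * y.
Proof. exact: tensor_mulZl. Qed.

Let mulZr (c : k) x y : c *: (x * y) = x * (c *: y).
Proof. exact: tensor_mulZr. Qed.

Lemma qbinomial x y n : y * x = z *: (x * y) ->
  (x + y) ^+ n = \sum_(i < n.+1) qbin n i *: (x ^+ i * y ^+ (n - i)).
Proof.
move=> yx.
have yxn i : y * x ^+ i = z ^+ i *: (x ^+ i * y).
  elim: i => [|i IH]; first by rewrite !expr0 scale1r mulr1 mul1r.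
  by rewrite [in LHS]exprS mulrA yx -mulZl -mulrA IH -mulZr scalerA mulrA -!exprS.
elim: n => [|n IH].
  by rewrite big_ord_recl big_ord0 addr0 /= scale1r mul1r.
rewrite exprS IH mulrDl !mulr_sumr.
rewrite [RHS]big_ord_recl [X in _ + X]big_ord_recl /= qbin0 !scale1r !expr0 !mul1r subn0.
rewrite addrCA -exprS; congr (_ + _).
transitivity (\sum_(i < n.+1) qbin n i *: (x ^+ i.+1 * y ^+ (n - i)) +
              \sum_(i < n.+1) (z ^+ i.+1 * qbin n i.+1) *: (x ^+ i.+1 * y ^+ (n - i))).
  congr (_ + _).
    by apply: eq_bigr => i _; rewrite -mulZr mulrA -exprS.
  rewrite [RHS]big_ord_recr /= qbin_small // mulr0 scale0r addr0.
  apply: eq_bigr => i _; rewrite -mulZr mulrA yxn -mulZl scalerA -mulrA -exprS mulrC.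
  by rewrite subnSK.
by rewrite -big_split /=; apply: eq_bigr => i _; rewrite -scalerDl subSS.
Qed.

Local Arguments qbin : simpl never.

(** The inner Gaussian binomials vanish at a primitive l-th root of unity. *)
Lemma qbinomial_root x y l : (0 < l)%N -> z ^+ l = 1 ->
  (forall j, (0 < j < l)%N -> z ^+ j != 1) ->
  y * x = z *: (x * y) -> (x + y) ^+ l = x ^+ l + y ^+ l.
Proof.
case: l => // l _ zl zj yx; rewrite (qbinomial _ yx).
rewrite big_ord_recl big_ord_recr /= qbinn qbin0 !scale1r subnn expr0 mulr1 mul1r.
rewrite subn0 [X in _ + (X + _)]big1.
  by rewrite add0r addrC.
move=> i _; rewrite (qbin_root zl zj).
  by rewrite scale0r.
by rewrite /bump /= add1n ltnS ltn_ord.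
Qed.

End QBinomial.

(** * The bicharacter *)

Section Bicharacter.
Variables (k : fieldType) (q : k) (m n : nat).
Hypothesis q0 : q != 0.
Local Notation I := 'I_(m + n).
Local Notation row := 'rV[int]_(m + n).

(** This is the coefficient of a_i b_j in star a b - star b a. *)
Definition order_sign (i j : I) : int := (j < i)%N%:Z - (i < j)%N%:Z.

Lemma starE (a b : row) :
  star a b = \sum_(i < m + n) \sum_(j < m + n) (j < i)%N%:Z * (a 0 i * b 0 j).
Proof.
apply: eq_bigr => i _; rewrite big_mkcond; apply: eq_bigr => j _.
by case: ifP => _; rewrite ?mul1r ?mul0r.
Qed.

Lemma star_antisym (a b : row) : star a b - star b a =
  \sum_(i < m + n) \sum_(j < m + n) order_sign i j * (a 0 i * b 0 j).
Proof.
rewrite !starE [X in _ - X]exchange_big /= -sumrB; apply: eq_bigr => i _.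
rewrite -sumrB; apply: eq_bigr => j _.
by rewrite /order_sign mulrBl [b 0 j * _]mulrC.
Qed.

Lemma starDl (a a' b : row) : star (a + a') b = star a b + star a' b.
Proof.
rewrite -big_split; apply: eq_bigr => i _; rewrite -big_split; apply: eq_bigr => j _.
by rewrite mxE mulrDl.
Qed.

Lemma starDr (a b b' : row) : star a (b + b') = star a b + star a b'.
Proof.
rewrite -big_split; apply: eq_bigr => i _; rewrite -big_split; apply: eq_bigr => j _.
by rewrite mxE mulrDr.
Qed.

(** The exponent of theta omits the pairings of the even part of one argument
    with the odd part of the other; this lemma shows that they vanish, so that theta
    depends on star of the whole tuples. *)
Lemma star_even_odd (a : 'rV_m) (b : 'rV_n) : star (row_mx a 0) (row_mx 0 b) = 0.
Proof.
rewrite /star big1 // => i _; rewrite big1 // => j ji.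
rewrite !mxE; case: splitP => [i' ei|i' _]; last by rewrite mxE mul0r.
case: splitP => [j' _|j' ej]; first by rewrite mxE mulr0.
have := ltn_ord i'; rewrite -ei ltnNge (leq_trans _ (ltnW ji)) //.
by rewrite ej leq_addr.
Qed.

Definition oddpart (x : zgrp m n) : row := row_mx 0 (zrep x.2).

Lemma tuple_split (x : zgrp m n) : zgrp_tuple x = row_mx x.1 0 + oddpart x.
Proof. by rewrite add_row_mx addr0 add0r. Qed.

Lemma theta_tuple (x y : zgrp m n) : theta q x y =
  (-1) ^ (star (oddpart x) (oddpart y) - star (oddpart y) (oddpart x)) *
  q ^ (star (zgrp_tuple x) (zgrp_tuple y) - star (zgrp_tuple y) (zgrp_tuple x)).
Proof.
rewrite /theta -/(oddpart x) -/(oddpart y); congr (_ * q ^ _).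
rewrite !tuple_split !(starDl, starDr) {2 4 6 8 10 12}/oddpart.
by rewrite !star_even_odd; ring.
Qed.

Lemma expfz_sum (a : k) (J : Type) (r : seq J) (E : J -> int) : a != 0 ->
  a ^ (\sum_(j <- r) E j) = \prod_(j <- r) a ^ E j.
Proof.
move=> a0; apply: (big_morph (fun e => a ^ e)); last exact: expr0z.
by move=> e e'; rewrite expfzDr.
Qed.

Lemma oddpartE (x : zgrp m n) i : oddpart x 0 i = (m <= i)%N%:Z * zgrp_tuple x 0 i.
Proof.
rewrite !mxE; case: splitP => [i' ->|i' ->]; rewrite ?mxE.
  by rewrite leqNgt ltn_ord mul0r.
by rewrite leq_addr mul1r.
Qed.

Lemma zbas_tuple (i j : I) : zgrp_tuple (zbas i) 0 j = (j == i)%:Z.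
Proof.
have z2 (b : bool) : ((b%:R : 'Z_2) : nat)%:Z = b%:Z by case: b.
rewrite /zbas mxE; case: (split_ordP i) => i' ->; case: (split_ordP j) => j' ->.
- by rewrite mxE eqxx eq_lshift; case: (_ == _).
- by rewrite !mxE eq_rlshift.
- by rewrite mxE eq_lrshift.
- by rewrite !mxE eqxx eq_rshift z2.
Qed.

Definition thetab_formula (i j : I) : k :=
  (-1) ^ (((m <= i) && (m <= j))%N%:Z * order_sign i j) * q ^ order_sign i j.

Lemma thetab_formula_neq0 i j : thetab_formula i j != 0.
Proof. by rewrite mulf_neq0 // expfz_neq0 // oppr_eq0 oner_eq0. Qed.

Lemma theta_prod_formula (x y : zgrp m n) : theta q x y =
  \prod_(i < m + n) \prod_(j < m + n)
     thetab_formula i j ^ (zgrp_tuple x 0 i * zgrp_tuple y 0 j).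
Proof.
have N1 : (-1 : k) != 0 by rewrite oppr_eq0 oner_eq0.
rewrite theta_tuple !star_antisym !expfz_sum // -big_split; apply: eq_bigr => i _.
rewrite /= !expfz_sum // -big_split; apply: eq_bigr => j _ /=.
rewrite expfzMl !exprz_exp !oddpartE; congr (_ ^ _ * _).
by case: (m <= i)%N; case: (m <= j)%N; rewrite /= !(mul1r, mul0r, mulr0).
Qed.

Lemma thetabE (i j : I) : thetab q i j = thetab_formula i j.
Proof.
rewrite /thetab theta_prod_formula (bigD1 i) //= [X in _ * X]big1 ?mulr1.
  rewrite (bigD1 j) //= big1 ?mulr1.
    by rewrite !zbas_tuple !eqxx mulr1 expr1z.
  by move=> l lj; rewrite !zbas_tuple (negbTE lj) mulr0 expr0z.
move=> l li; rewrite big1 // => h _.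
by rewrite !zbas_tuple (negbTE li) mul0r expr0z.
Qed.

(** Theta is the bimultiplicative extension of its values on basis vectors, even
    though elements of Z_2 enter through their representatives. *)
Lemma theta_prod (x y : zgrp m n) : theta q x y =
  \prod_(i < m + n) \prod_(j < m + n)
     thetab q i j ^ (zgrp_tuple x 0 i * zgrp_tuple y 0 j).
Proof.
by rewrite theta_prod_formula; apply: eq_bigr => i _; apply: eq_bigr => j _; rewrite thetabE.
Qed.

Lemma thetab_neq0 (i j : I) : thetab q i j != 0.
Proof. by rewrite thetabE thetab_formula_neq0. Qed.

Lemma thetabii (i : I) : thetab q i i = 1.
Proof. by rewrite thetabE /thetab_formula /order_sign ltnn subrr mulr0 !expr0z mulr1. Qed.

Lemma thetab_sym (i j : I) : thetab q j i = (thetab q i j)^-1.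
Proof.
rewrite !thetabE /thetab_formula invfM !invr_expz.
have -> : order_sign j i = - order_sign i j by rewrite /order_sign opprB.
by rewrite andbC mulrN.
Qed.

Lemma thetab_even_root N (i j : I) : q ^+ N = 1 -> ~~ ((m <= i) && (m <= j))%N ->
  thetab q i j ^+ N = 1.
Proof.
move=> qN /negbTE ij; rewrite thetabE /thetab_formula ij mul0r expr0z mul1r.
by rewrite exprnP exprz_exp mulrC -exprz_exp -exprnP qN exp1rz.
Qed.

Lemma Zp_intr_congr N (x : int) : (1 < N)%N ->
  exists d, ((x%:~R : 'Z_N) : nat)%:Z = x + N%:Z * d.
Proof.
move=> N1; set c := (x%:~R : 'Z_N).
suff h (z : int) : z%:~R = 0 :> 'Z_N -> exists d, z = N%:Z * d.
  have [|d hd] := h (c%:Z - x).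
    by rewrite rmorphB /= -[(c%:Z)%:~R]/(c%:R) natr_Zp subrr.
  by exists d; rewrite -hd addrC subrK.
have hn (a : nat) : a%:R = 0 :> 'Z_N -> exists d, a%:Z = N%:Z * d.
  move=> /(congr1 val); rewrite /= val_Zp_nat // => /eqP /dvdnP [d ->].
  by exists d%:Z; rewrite mulrC.
case: z => a; first exact: hn.
rewrite NegzE rmorphN /= => /eqP; rewrite oppr_eq0 => /eqP /hn [d ->].
by exists (- d); rewrite mulrN.
Qed.

(** In the product formula only the even coordinates change, by multiples of N,
    and q^N = 1; for two odd indices the exponents do not change at all. *)
Lemma theta_reduction N (x y : zgrp m n) : (1 < N)%N -> q ^+ N = 1 ->
  thetaN q (red_zgrp N x) (red_zgrp N y) = theta q x y.
Proof.
move=> N1 qN; rewrite /thetaN !theta_prod; apply: eq_bigr => i _; apply: eq_bigr => j _.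
have lE (z : zgrp m n) l : exists d,
    zgrp_tuple (lift_zgrp (red_zgrp N z)) 0 l = zgrp_tuple z 0 l + N%:Z * d /\
    ((m <= l)%N -> d = 0).
  rewrite !mxE; case: (split_ordP l) => l' -> /=.
    rewrite !mxE; have [d ->] := Zp_intr_congr (z.1 0 l') N1.
    by exists d; split=> //; rewrite leqNgt ltn_ord.
  by exists 0; rewrite mulr0 addr0.
have [d [-> di]] := lE x i; have [e [-> ej]] := lE y j.
have [/andP[/di -> /ej ->]|ij] := boolP ((m <= i)%N && (m <= j)%N).
  by rewrite mulr0 !addr0.
set a := zgrp_tuple x 0 i; set b := zgrp_tuple y 0 j.
have -> : (a + N%:Z * d) * (b + N%:Z * e) = a * b + N%:Z * (d * b + a * e + N%:Z * d * e).
  by ring.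
rewrite expfzDr ?thetab_neq0 // -(exprz_exp _ N%:Z) -exprnP thetab_even_root //.
by rewrite exp1rz mulr1.
Qed.

End Bicharacter.

(** * Commutation relations of the generators *)

Section SkewCommutation.
Variables (k : fieldType) (A : algType k).

Definition qcomm (c : k) (x y : A) : Prop := x * y = c *: (y * x).

Lemma qcomm_sym c x y : c != 0 -> qcomm c x y -> qcomm c^-1 y x.
Proof. by rewrite /qcomm => c0 ->; rewrite scalerA mulVf // scale1r. Qed.

Lemma qcommMl c d x y z : qcomm c x z -> qcomm d y z -> qcomm (c * d) (x * y) z.
Proof.
rewrite /qcomm => xz yz.
by rewrite -mulrA yz -scalerAr (mulrA x) xz -scalerAl scalerA (mulrC d) -mulrA.
Qed.

Lemma qcommMr c d x y z : qcomm c z x -> qcomm d z y -> qcomm (c * d) z (x * y).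
Proof.
rewrite /qcomm => zx zy.
by rewrite mulrA zx -scalerAl -(mulrA x z) zy -scalerAr scalerA mulrA.
Qed.

Lemma qcomm1l x : qcomm 1 1 x.
Proof. by rewrite /qcomm scale1r mul1r mulr1. Qed.

Lemma qcomm1P x y : qcomm 1 x y <-> x * y = y * x.
Proof. by rewrite /qcomm scale1r. Qed.

Lemma qcomm_prodl (I : Type) (r : seq I) (c : I -> k) (u : I -> A) z :
  (forall i, qcomm (c i) (u i) z) -> qcomm (\prod_(i <- r) c i) (\prod_(i <- r) u i) z.
Proof.
move=> h; apply: (big_rec2 (fun c w => qcomm c w z)); first exact: qcomm1l.
by move=> i c' w _; apply: qcommMl.
Qed.

Lemma qcomm_prodr (I : Type) (r : seq I) (c : I -> k) (u : I -> A) z :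
  (forall i, qcomm (c i) z (u i)) -> qcomm (\prod_(i <- r) c i) z (\prod_(i <- r) u i).
Proof.
move=> h; apply: (big_rec2 (fun c w => qcomm c z w)).
  by apply/qcomm1P; rewrite mulr1 mul1r.
by move=> i c' w _; apply: qcommMr.
Qed.

Lemma qcomm_prod (I : Type) (r : seq I) (c : I -> I -> k) (u v : I -> A)
    (a b : I -> nat) :
  (forall i j, qcomm (c i j) (u j) (v i)) ->
  qcomm (\prod_(i <- r) \prod_(j <- r) c i j ^+ (a i * b j))
    (\prod_(j <- r) u j ^+ b j) (\prod_(i <- r) v i ^+ a i).
Proof.
move=> h; apply: qcomm_prodr => i; apply: qcomm_prodl => j.
by rewrite exprM; apply: qcommXl; apply: qcommX; apply: h.
Qed.

End SkewCommutation.

Section SplitShift.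
Variables m n : nat.

Lemma split_lshift (i : 'I_m) : split (lshift n i) = inl i.
Proof. exact: (unsplitK (inl i)). Qed.

Lemma split_rshift (i : 'I_n) : split (rshift m i) = inr i.
Proof. exact: (unsplitK (inr i)). Qed.

End SplitShift.

Section Presentation.
Variables (k : fieldType) (q : k) (m n : nat).
Hypothesis q0 : q != 0.
Local Notation I := 'I_(m + n).
Local Notation F := (freealg k (dgen m n)).
Local Notation gen := (@fgen k (dgen m n)).

(** The algebra is left abstract: the results below are applied both to D_q(m|n)
    and to its restricted quotient. *)
Variables (A : algType k) (dpi : {lrmorphism F -> A}).
Hypothesis dpi_rel : forall u v, drel q u v -> dpi u = dpi v.
Local Notation T := (tensor A A).
Local Notation dpart i := (dpi (wpart k i)).
Local Notation dsig i := (dpi (wsig k i)).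
Local Notation dsigV i := (dpi (wsigV k i)).
Local Notation dtheta i := (dpi (wtheta k i)).
Local Notation dthetaV i := (dpi (wthetaV k i)).
Local Notation dtau j := (dpi (wtau k m j)).

Lemma dpiM x y : dpi (x * y) = dpi x * dpi y.
Proof. exact: rmorphM. Qed.

Lemma dpi1 : dpi 1 = 1.
Proof. exact: rmorph1. Qed.

Lemma dpiZ c x : dpi (c *: x) = c *: dpi x.
Proof. exact: linearZ. Qed.

Lemma dsigK i : dsig i * dsigV i = 1.
Proof. by rewrite -dpiM (dpi_rel (DSigK q i)) dpi1. Qed.

Lemma dsigVK i : dsigV i * dsig i = 1.
Proof. by rewrite -dpiM (dpi_rel (DSigVK q i)) dpi1. Qed.

Lemma dthetaK i : dtheta i * dthetaV i = 1.
Proof. by rewrite -dpiM (dpi_rel (DThetaK q i)) dpi1. Qed.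

Lemma dthetaVK i : dthetaV i * dtheta i = 1.
Proof. by rewrite -dpiM (dpi_rel (DThetaVK q i)) dpi1. Qed.

Lemma dtauK j : dtau j * dtau j = 1.
Proof. by rewrite -dpiM -expr2 (dpi_rel (DTau2 q m j)) dpi1. Qed.

(** The relations give the commutation of these only; that of their inverses
    follows. *)
Inductive basic_group_like : A -> Prop :=
| BasicSig i : basic_group_like (dsig i)
| BasicTheta i : basic_group_like (dtheta i)
| BasicTau j : basic_group_like (dtau j).

Lemma basic_comm a b : basic_group_like a -> basic_group_like b -> a * b = b * a.
Proof.
have st i j : dsig i * dtheta j = dtheta j * dsig i.
  by rewrite -!dpiM (dpi_rel (DSigTheta q j i)).
have su i j : dsig i * dtau j = dtau j * dsig i.
  by rewrite -!dpiM (dpi_rel (DSigTau q i j)).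
have tu i j : dtau i * dtheta j = dtheta j * dtau i.
  by rewrite -!dpiM (dpi_rel (DTauTheta q j i)).
case=> [i|i|i] [j|j|j] //.
- by rewrite -!dpiM (dpi_rel (DSigC q i j)).
- by rewrite -!dpiM (dpi_rel (DThetaD q i j)) (dpi_rel (DThetaC q i j)).
- by rewrite -!dpiM (dpi_rel (DTauC q m i j)).
Qed.

Definition is_part (g : dgen m n) : bool := if g is GPartial _ then true else false.

Definition gen_inv (g : dgen m n) : dgen m n :=
  match g with
  | GPartial i => GPartial i
  | GTheta i => GThetaV i
  | GThetaV i => GTheta i
  | GSigma i => GSigmaV i
  | GSigmaV i => GSigma i
  | GTau j => GTau m j
  end.

Local Notation dg := (fun g => dpi (gen g)).

Lemma gen_mulV g : ~~ is_part g -> dg g * dg (gen_inv g) = 1.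
Proof.
case: g => // i _ /=; [exact: dthetaK|exact: dthetaVK|exact: dsigK|exact: dsigVK|].
exact: dtauK.
Qed.

Lemma gen_Vmul g : ~~ is_part g -> dg (gen_inv g) * dg g = 1.
Proof.
case: g => // i _ /=; [exact: dthetaVK|exact: dthetaK|exact: dsigVK|exact: dsigK|].
exact: dtauK.
Qed.

Lemma comm_inverse (x x' y : A) : x * x' = 1 -> x' * x = 1 -> x * y = y * x ->
  x' * y = y * x'.
Proof.
move=> xx x'x xy; rewrite -[LHS]mulr1 -xx mulrA -(mulrA x') -xy mulrA x'x.
by rewrite mul1r.
Qed.

Lemma comm_group_gen (y : A) : (forall b, basic_group_like b -> b * y = y * b) ->
  forall g, ~~ is_part g -> dg g * y = y * dg g.
Proof.
move=> yb [] // i _.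
- exact: yb (BasicTheta i).
- by apply: (comm_inverse (dthetaK i) (dthetaVK i)); apply: yb (BasicTheta i).
- exact: yb (BasicSig i).
- by apply: (comm_inverse (dsigK i) (dsigVK i)); apply: yb (BasicSig i).
- exact: yb (BasicTau i).
Qed.

Lemma gen_comm g h : ~~ is_part g -> ~~ is_part h -> dg g * dg h = dg h * dg g.
Proof.
move=> Gg Gh; apply: (comm_group_gen _ Gg) => b Bb; apply: esym.
apply: (comm_group_gen _ Gh) => b' Bb'.
exact: basic_comm.
Qed.

(** A product of group-like generators has a coproduct and an antipode that depend
    only on its value, so that every relation between two such words is respected
    without looking at it. *)
Inductive gword : F -> Prop :=
| GWord1 : gword 1
| GWordGen g w : ~~ is_part g -> gword w -> gword (gen g * w).

Lemma gword_gen g : ~~ is_part g -> gword (gen g).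
Proof. by move=> Gg; rewrite -[gen g]mulr1; apply: GWordGen => //; apply: GWord1. Qed.

Lemma gwordM u v : gword u -> gword v -> gword (u * v).
Proof.
move=> hu hv; elim: hu => [|g w Gg _ IH]; first by rewrite mul1r.
by rewrite -mulrA; apply: GWordGen.
Qed.

Lemma gwordX u a : gword u -> gword (u ^+ a).
Proof.
move=> hu; elim: a => [|a IH]; first exact: GWord1.
by rewrite exprS; apply: gwordM.
Qed.

Lemma gword_prod (J : Type) (r : seq J) (u : J -> F) :
  (forall j, gword (u j)) -> gword (\prod_(j <- r) u j).
Proof. by move=> hu; apply: big_ind => //; [exact: GWord1|exact: gwordM]. Qed.

Lemma gword_Theta a : gword (wTheta k a).
Proof.
by apply: gword_prod => i; case: (a 0 i) => p; apply: gwordX; apply: gword_gen.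
Qed.

Lemma gword_tauall : gword (wtauall k m n).
Proof. by apply: gword_prod => j; apply: gword_gen. Qed.

Lemma conj_comm (g g' x : A) c : g' * g = 1 -> g * x * g' = c *: x ->
  g * x = c *: (x * g).
Proof. by move=> g'g h; rewrite scalerAl -h -!mulrA g'g mulr1. Qed.

Lemma conj_commV (g g' x : A) c : g' * g = 1 -> c != 0 -> g * x * g' = c *: x ->
  g' * x = c^-1 *: (x * g').
Proof.
move=> g'g c0 h; apply: (canRL (scalerK c0)).
by rewrite scalerAr -h !mulrA g'g mul1r.
Qed.

Definition sigchar (i j : I) : k := (-1) ^+ ((m <= i)%N && (i == j)) * q ^- (i == j).

Lemma sigchar_neq0 i j : sigchar i j != 0.
Proof. by rewrite mulf_neq0 ?signr_eq0 // invr_neq0 ?expf_neq0. Qed.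

Lemma dtheta_part i j : dtheta j * dpart i = thetab q i j *: (dpart i * dtheta j).
Proof.
apply: (conj_comm (dthetaVK j)).
by rewrite -!dpiM (dpi_rel (DThetaPart q i j)) dpiZ.
Qed.

Lemma dthetaV_part i j :
  dthetaV j * dpart i = (thetab q i j)^-1 *: (dpart i * dthetaV j).
Proof.
apply: (conj_commV (dthetaVK j)); first exact: thetab_neq0.
by rewrite -!dpiM (dpi_rel (DThetaPart q i j)) dpiZ.
Qed.

Lemma dsig_part i j : dsig j * dpart i = sigchar i j *: (dpart i * dsig j).
Proof.
apply: (conj_comm (dsigVK j)).
by rewrite -!dpiM (dpi_rel (DSigPart q i j)) dpiZ.
Qed.

Lemma dsigV_part i j :
  dsigV j * dpart i = (sigchar i j)^-1 *: (dpart i * dsigV j).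
Proof.
apply: (conj_commV (dsigVK j)); first exact: sigchar_neq0.
by rewrite -!dpiM (dpi_rel (DSigPart q i j)) dpiZ.
Qed.

Lemma dtau_part i j :
  dtau j * dpart i = (-1) ^+ (i == rshift m j) *: (dpart i * dtau j).
Proof. by rewrite -!dpiM (dpi_rel (DTauPart q i j)) dpiZ. Qed.

Lemma dpartC i j : dpart i * dpart j = thetab q i j *: (dpart j * dpart i).
Proof. by rewrite -!dpiM (dpi_rel (DPartC q i j)) dpiZ. Qed.

Lemma dpart_sq j : dpart (rshift m j) ^+ 2 = 0.
Proof. by rewrite -rmorphXn /= (dpi_rel (DPart2 q m j)) rmorph0. Qed.

(** With r_i and h_i the values of the first and third of these words, the
    prescribed coproduct is partial_i (x) r_i + h_i (x) partial_i for even and odd i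
    alike, which allows one computation to serve both parities. The two other words
    represent the inverses. *)
Definition rword (i : I) : F := if split i is inl _ then wsigV k i else 1.
Definition rwordV (i : I) : F := if split i is inl _ then wsig k i else 1.
Definition hword (i : I) : F :=
  wthetaV k i * match split i with inl _ => wsig k i | inr j => wtau k m j end.
Definition hwordV (i : I) : F :=
  match split i with inl _ => wsigV k i | inr j => wtau k m j end * wtheta k i.

Lemma gword_rword i : gword (rword i).
Proof. by rewrite /rword; case: split => _; [apply: gword_gen|apply: GWord1]. Qed.

Lemma gword_rwordV i : gword (rwordV i).
Proof. by rewrite /rwordV; case: split => _; [apply: gword_gen|apply: GWord1]. Qed.

Lemma gword_hword i : gword (hword i).
Proof. by rewrite /hword; case: split => j; apply: gwordM; apply: gword_gen. Qed.

Lemma gword_hwordV i : gword (hwordV i).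
Proof. by rewrite /hwordV; case: split => j; apply: gwordM; apply: gword_gen. Qed.

Local Notation r i := (dpi (rword i)).
Local Notation rV i := (dpi (rwordV i)).
Local Notation h i := (dpi (hword i)).
Local Notation hV i := (dpi (hwordV i)).

Lemma gword_comm u v : gword u -> gword v -> dpi u * dpi v = dpi v * dpi u.
Proof.
have step g w : ~~ is_part g -> gword w -> dg g * dpi w = dpi w * dg g.
  move=> Gg; elim=> [|g' w' Gg' _ IH]; first by rewrite dpi1 mulr1 mul1r.
  by rewrite dpiM mulrA (gen_comm Gg Gg') -!mulrA IH.
move=> hu hv; elim: hu => [|g w Gg _ IH]; first by rewrite dpi1 mulr1 mul1r.
by rewrite dpiM -mulrA IH !mulrA step.
Qed.

Lemma r_mulV i : r i * rV i = 1.
Proof.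
rewrite -dpiM /rword /rwordV; case: split => _; first by rewrite dpiM [LHS]dsigVK.
by rewrite mulr1 dpi1.
Qed.

Lemma r_Vmul i : rV i * r i = 1.
Proof. by rewrite gword_comm ?r_mulV //; [exact: gword_rwordV|exact: gword_rword]. Qed.

Lemma h_mulV i : h i * hV i = 1.
Proof.
rewrite /hword /hwordV; case: split => j; rewrite !dpiM mulrA -(mulrA (dpi (wthetaV _ _))).
  by rewrite [_ * dpi (wsigV _ _)]dsigK mulr1 [LHS]dthetaVK.
by rewrite [_ * dpi (wtau _ _ _)]dtauK mulr1 [LHS]dthetaVK.
Qed.

Lemma h_Vmul i : hV i * h i = 1.
Proof. by rewrite gword_comm ?h_mulV //; [exact: gword_hwordV|exact: gword_hword]. Qed.

Lemma r_qcomm_part i (j : I) : i != j -> qcomm 1 (r j) (dpart i).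
Proof.
move=> ij; rewrite /rword; case: split => j'; last by rewrite dpi1; apply: qcomm1l.
have := dsigV_part i j.
by rewrite /sigchar (negbTE ij) andbF mul1r expr0 !invr1.
Qed.

Lemma h_qcomm_part i (j : I) : i != j -> qcomm (thetab q i j)^-1 (h j) (dpart i).
Proof.
move=> ij; rewrite /hword dpiM -[X in qcomm X]mulr1; apply: qcommMl.
  exact: dthetaV_part.
case: split_ordP => j' e.
  have := dsig_part i j.
  by rewrite /sigchar (negbTE ij) andbF mul1r expr0 invr1.
by have := dtau_part i j'; rewrite -e (negbTE ij) expr0.
Qed.

Lemma rV_qcomm_part i (j : I) : i != j -> qcomm 1 (rV j) (dpart i).
Proof.
move=> ij; apply/qcomm1P; apply: (comm_inverse (r_mulV j) (r_Vmul j)).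
exact/qcomm1P/r_qcomm_part.
Qed.

Lemma hV_qcomm_part i (j : I) : i != j -> qcomm (thetab q i j) (hV j) (dpart i).
Proof.
move=> /h_qcomm_part hp; have t0 := thetab_neq0 q0 i j.
have := qcomm_sym (invr_neq0 t0) hp; rewrite /qcomm invrK => e.
rewrite -[LHS]mulr1 -(h_mulV j) mulrA -(mulrA (hV j)) e -scalerAr mulrA h_Vmul.
by rewrite mul1r scalerAl.
Qed.

Lemma r_qcomm_self_even (i : 'I_m) (j := lshift n i) : qcomm q (r j) (dpart j).
Proof.
rewrite /rword split_lshift.
have := dsigV_part j j.
by rewrite /sigchar eqxx leqNgt /= ltn_ord mul1r expr1 invrK.
Qed.

Lemma h_qcomm_self_even (i : 'I_m) (j := lshift n i) : qcomm q^-1 (h j) (dpart j).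
Proof.
rewrite /hword split_lshift dpiM -[X in qcomm X]mul1r; apply: qcommMl.
  by have := dthetaV_part j j; rewrite (thetabii q0) invr1.
have := dsig_part j j.
by rewrite /sigchar eqxx leqNgt /= ltn_ord mul1r expr1.
Qed.

Lemma r_odd (i : 'I_n) (j := rshift m i) : r j = 1.
Proof. by rewrite /rword split_rshift dpi1. Qed.

Lemma rV_odd (i : 'I_n) (j := rshift m i) : rV j = 1.
Proof. by rewrite /rwordV split_rshift dpi1. Qed.

Lemma h_qcomm_self_odd (i : 'I_n) (j := rshift m i) : qcomm (-1) (h j) (dpart j).
Proof.
rewrite /hword split_rshift dpiM -[X in qcomm X]mul1r; apply: qcommMl.
  by have := dthetaV_part j j; rewrite (thetabii q0) invr1.
by have := dtau_part j i; rewrite eqxx expr1.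
Qed.

(** * Coproduct and antipode respect the relations *)

Definition comul_part (i : I) : T := tens (dpart i) (r i) + tens (h i) (dpart i).

Definition comul_gen (g : dgen m n) : T :=
  if g is GPartial i then comul_part i else tens (dg g) (dg g).

(** The value forced by the antipode axiom; it becomes the prescribed one after
    moving the group-likes to the left. *)
Definition antipode_part (i : I) : A := - (hV i * dpart i * rV i).

Definition antipode_gen (g : dgen m n) : A :=
  if g is GPartial i then antipode_part i else dg (gen_inv g).

Let tmulL (v : T) : linear (fun u : T => u * v).
Proof. exact: tensor_mul_linl. Qed.

Let tmulR (u : T) : linear (fun v : T => u * v).
Proof. exact: tensor_mul_linr. Qed.

Let omulL (v : A) : linear (fun u : A => v * u).
Proof. by move=> c x y; rewrite mulrDr scalerAr. Qed.

Let omulR (u : A) : linear (fun v : A => v * u).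
Proof. by move=> c x y; rewrite mulrDl scalerAl. Qed.

Let omulA : associative (fun x y : A => y * x).
Proof. by move=> x y z; rewrite mulrA. Qed.

Definition free_comul : {linear F -> T} := free_eval_lin (fun x y : T => x * y) 1 comul_gen.
Definition free_antipode : {linear F -> A} :=
  free_eval_lin (fun x y : A => y * x) 1 antipode_gen.

Lemma free_comul_gen g : free_comul (gen g) = comul_gen g.
Proof. exact: (free_eval_gen _ tmulR (@mulr1 T)). Qed.

Lemma free_comul1 : free_comul 1 = 1.
Proof. exact: free_eval1. Qed.

Lemma free_comulM x y : free_comul (x * y) = free_comul x * free_comul y.
Proof. exact: (free_evalM _ tmulL tmulR (@mulrA T) (@mul1r T)). Qed.

Lemma free_antipode_gen g : free_antipode (gen g) = antipode_gen g.
Proof. exact: (free_eval_gen _ omulR (@mul1r A)). Qed.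

Lemma free_antipode1 : free_antipode 1 = 1.
Proof. exact: free_eval1. Qed.

Lemma free_antipodeM x y : free_antipode (x * y) = free_antipode y * free_antipode x.
Proof. exact: (free_evalM _ omulL omulR omulA (@mulr1 A)). Qed.

Lemma free_comul_gword w : gword w -> free_comul w = tens (dpi w) (dpi w).
Proof.
elim=> [|g {}w Gg _ IH]; first by rewrite free_comul1 dpi1.
by rewrite free_comulM IH free_comul_gen dpiM -tensM; case: g Gg.
Qed.

Lemma free_antipode_gword w : gword w ->
  free_antipode w * dpi w = 1 /\ dpi w * free_antipode w = 1.
Proof.
elim=> [|g {}w Gg _ [IH1 IH2]]; first by rewrite free_antipode1 dpi1 mulr1.
have -> : free_antipode (gen g * w) = free_antipode w * dg (gen_inv g).
  by rewrite free_antipodeM free_antipode_gen; case: g Gg.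
rewrite dpiM; split; rewrite mulrA.
  by rewrite -(mulrA (free_antipode w)) gen_Vmul // mulr1.
by rewrite -(mulrA (dg g)) IH2 mulr1 gen_mulV.
Qed.

(** Both values are determined by dpi u: the first is its tensor square and the
    second its inverse. *)
Lemma gword_rel u v : gword u -> gword v -> dpi u = dpi v ->
  free_comul u = free_comul v /\ free_antipode u = free_antipode v.
Proof.
move=> hu hv uv; split; first by rewrite !free_comul_gword // uv.
have [_ h1] := free_antipode_gword hv; have [h2 _] := free_antipode_gword hu.
by rewrite -[LHS]mulr1 -h1 -uv mulrA h2 mul1r.
Qed.

(** Group-likes commute with r_i and h_i, so conjugation by a group-like scales
    both terms of the coproduct by the same factor. *)
Lemma conj_comul_part (u v : F) (i : I) c : gword u -> gword v -> dpi u * dpi v = 1 ->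
  dpi u * dpart i * dpi v = c *: dpart i ->
  tens (dpi u) (dpi u) * comul_part i * tens (dpi v) (dpi v) = c *: comul_part i.
Proof.
move=> hu hv uv e; rewrite /comul_part mulrDr mulrDl !tensM e.
rewrite (gword_comm hu (gword_rword i)) (gword_comm hu (gword_hword i)).
by rewrite -!(mulrA (dpi (_ i))) uv !mulr1 tensZl tensZr scalerDr.
Qed.

Lemma conj_antipode_part (u v : F) (i : I) c : gword u -> gword v -> dpi v * dpi u = 1 ->
  dpi u * dpart i * dpi v = c *: dpart i ->
  dpi u * antipode_part i * dpi v = c *: antipode_part i.
Proof.
move=> hu hv vu e; rewrite /antipode_part mulrN mulNr scalerN; congr (- _).
have -> : dpi u * (hV i * dpart i * rV i) * dpi v =
    hV i * (dpi u * dpart i * dpi v) * rV i.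
  rewrite !mulrA (gword_comm hu (gword_hwordV i)) -!mulrA.
  by rewrite (gword_comm hv (gword_rwordV i)).
by rewrite e -scalerAr -scalerAl.
Qed.

(** The outer terms of the two products agree by the relation itself, and the mixed
    terms are exchanged. *)
Lemma comul_part_comm i j :
  comul_part i * comul_part j = thetab q i j *: (comul_part j * comul_part i).
Proof.
have [<-|ij] := eqVneq i j; first by rewrite thetabii // scale1r.
have ji : j != i by rewrite eq_sym.
rewrite /comul_part !mulrDl !mulrDr !tensM !scalerDr.
have rr := gword_comm (gword_rword i) (gword_rword j).
have hh := gword_comm (gword_hword i) (gword_hword j).
have rij : dpart i * r j = r j * dpart i.
  by apply/esym/qcomm1P; apply: r_qcomm_part.
have rji : r i * dpart j = dpart j * r i.
  by apply/qcomm1P; apply: r_qcomm_part.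
have hji : h i * dpart j = thetab q i j *: (dpart j * h i).
  by have := h_qcomm_part ji; rewrite thetab_sym // invrK.
have hij : dpart i * h j = thetab q i j *: (h j * dpart i).
  have := qcomm_sym (invr_neq0 (thetab_neq0 q0 i j)) (h_qcomm_part ij).
  by rewrite invrK.
rewrite (dpartC i j) rr hh rij rji hji hij !tensZl !tensZr.
by rewrite [X in _ = X + _]addrC addrACA [X in _ = X + _]addrC.
Qed.

(** The antipode values are products of three factors, and the nine scalars
    exchanging them multiply to theta. *)
Lemma antipode_part_comm i j :
  antipode_part j * antipode_part i = thetab q i j *: (antipode_part i * antipode_part j).
Proof.
have [<-|ij] := eqVneq i j; first by rewrite thetabii // scale1r.
have ji : j != i by rewrite eq_sym.
have t0 := thetab_neq0 q0 i j.
rewrite /antipode_part !mulrNN.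
have gg u v : gword u -> gword v -> qcomm 1 (dpi u) (dpi v).
  by move=> hu hv; apply/qcomm1P; apply: gword_comm.
have ph : qcomm (thetab q i j) (dpart j) (hV i).
  by have := qcomm_sym (thetab_neq0 q0 j i) (hV_qcomm_part ji); rewrite thetab_sym // invrK.
have pr : qcomm 1 (dpart j) (rV i).
  by have := qcomm_sym (oner_neq0 k) (rV_qcomm_part ji); rewrite invr1.
have pp : qcomm (thetab q i j)^-1 (dpart j) (dpart i).
  by rewrite -thetab_sym //; apply: dpartC.
have G1 := gword_hwordV; have G2 := gword_rwordV.
have := qcommMl (qcommMl
   (qcommMr (qcommMr (gg _ _ (G1 j) (G1 i)) (hV_qcomm_part ij)) (gg _ _ (G1 j) (G2 i)))
   (qcommMr (qcommMr ph pp) pr))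
   (qcommMr (qcommMr (gg _ _ (G2 j) (G1 i)) (rV_qcomm_part ij)) (gg _ _ (G2 j) (G2 i))).
by rewrite /qcomm !mul1r !mulr1 divff // mulr1.
Qed.

(** The square of an odd partial_j vanishes and h_j anticommutes with it, so the
    mixed terms cancel. *)
Lemma comul_part_sq j : comul_part (rshift m j) * comul_part (rshift m j) = 0.
Proof.
have p2 := dpart_sq j; rewrite expr2 in p2.
have hp := h_qcomm_self_odd j; rewrite /qcomm in hp.
rewrite /comul_part r_odd mulrDl !mulrDr !tensM p2 tens0l tens0r add0r addr0.
by rewrite mulr1 mul1r hp tensZl scaleN1r subrr.
Qed.

Lemma antipode_part_sq j : antipode_part (rshift m j) * antipode_part (rshift m j) = 0.
Proof.
have p2 := dpart_sq j; rewrite expr2 in p2.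
set i := rshift m j in p2 *.
have hp : qcomm (-1) (dpart i) (hV i).
  have hp := h_qcomm_self_odd j; rewrite /qcomm -/i in hp *.
  rewrite -[LHS]mul1r -(h_Vmul i) -!mulrA (mulrA (h i)) hp -scalerAl.
  by rewrite -scalerAr -mulrA h_mulV mulr1.
rewrite /antipode_part rV_odd mulr1 mulrNN -mulrA (mulrA (dpart i)) hp -scalerAl -scalerAr.
by rewrite -!mulrA p2 !mulr0 scaler0.
Qed.

(** The relations that do not involve any partial_i are settled by [gword_rel]. *)
Lemma free_maps_drel u v : drel q u v ->
  free_comul u = free_comul v /\ free_antipode u = free_antipode v.
Proof.
move=> uv; have e := dpi_rel uv; move: uv e.
have Z (c : k) (V : lmodType k) (f : {linear F -> V}) x : f (c *: x) = c *: f x.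
  exact: linearZ.
have Gg g : ~~ is_part g -> free_comul (gen g) = tens (dg g) (dg g) /\
    free_antipode (gen g) = dg (gen_inv g).
  by rewrite free_comul_gen free_antipode_gen; case: g.
case=> [i|i|i j||j|i j|i j|i|i|i j|i j|i j|i j|i i' _ _|i i' _ _|i j|i j|i j|i j|j] e;
  try by apply: gword_rel => //;
    repeat (first [exact: GWord1 | exact: gword_Theta | exact: gword_tauall
                  | exact: gword_gen | apply: gwordM | apply: gwordX]).
- rewrite !free_comulM !free_antipodeM !Z !free_comul_gen !free_antipode_gen /=; split.
    apply: conj_comul_part => //; [exact: gword_gen|exact: gword_gen|exact: dthetaK|].
    by rewrite -!dpiM e dpiZ.
  rewrite mulrA.
  apply: conj_antipode_part => //; [exact: gword_gen|exact: gword_gen|exact: dthetaVK|].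
  by rewrite -!dpiM e dpiZ.
- rewrite !free_comulM !free_antipodeM !Z !free_comul_gen !free_antipode_gen /=; split.
    apply: conj_comul_part => //; [exact: gword_gen|exact: gword_gen|exact: dsigK|].
    by rewrite -!dpiM e dpiZ.
  rewrite mulrA.
  apply: conj_antipode_part => //; [exact: gword_gen|exact: gword_gen|exact: dsigVK|].
  by rewrite -!dpiM e dpiZ.
- rewrite !Z !free_comulM !free_antipodeM !free_comul_gen !free_antipode_gen /=.
  have hg : gword (wtau k m j) by apply: gword_gen.
  have tt := dtauK j.
  have e' : dpi (wtau k m j) * dpart i * dpi (wtau k m j) =
      (-1) ^+ (i == rshift m j) *: dpart i.
    by rewrite -dpiM e dpiZ dpiM -scalerAl -mulrA dtauK mulr1.
  split.
    have := conj_comul_part hg hg tt e'.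
    move=> /(congr1 (fun x => x * tens (dpi (wtau k m j)) (dpi (wtau k m j)))).
    rewrite -mulrA tensM [dpi (wtau _ _ _) * _]tt [tens 1 1 as X in _ * X](erefl (1 : T)).
    by rewrite mulr1 -tensor_mulZl.
  have := conj_antipode_part hg hg tt e'.
  move=> /(congr1 (fun x => dpi (wtau k m j) * x)).
  rewrite !mulrA [dpi (wtau _ _ _) * _]tt mul1r => ->.
  by rewrite -scalerAr.
- rewrite !Z !free_comulM !free_antipodeM !free_comul_gen !free_antipode_gen /=.
  split; first exact: comul_part_comm.
  exact: antipode_part_comm.
- rewrite !expr2 !free_comulM !free_antipodeM !free_comul_gen !free_antipode_gen.
  rewrite (linear0 free_comul) (linear0 free_antipode) /=.
  split; first exact: comul_part_sq.
  exact: antipode_part_sq.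
Qed.

Let dpi_linear : {linear F -> A} := dpi.

Lemma free_comul_ideal x : ideal (drel_set q (m := m) (n := n)) x -> free_comul x = 0.
Proof.
apply: (multiplicative_ideal_kernel (mul := fun x y : T => x * y)) => //.
  exact: free_comulM.
by move=> _ [u [v [uv ->]]]; rewrite linearB (free_maps_drel uv).1 subrr.
Qed.

Lemma free_antipode_ideal x : ideal (drel_set q (m := m) (n := n)) x -> free_antipode x = 0.
Proof.
apply: (multiplicative_ideal_kernel (mul := fun x y : A => y * x)) => //.
  exact: free_antipodeM.
by move=> _ [u [v [uv ->]]]; rewrite linearB (free_maps_drel uv).2 subrr.
Qed.

Lemma generators_generate :
  (forall P : A -> Prop, (forall w, P (dpi w)) -> forall x, P x) ->
  generates [set x | exists g, x = dg g].
Proof.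
move=> dpi_surj P hP P1 Pg; apply: dpi_surj => w.
apply: (@freealg_ind _ _ [set w | P (dpi w)]).
- exact: (preimage_subspace dpi_linear).
- by rewrite /= dpi1.
- by move=> g y Py /=; rewrite dpiM; apply: Pg => //; exists g.
Qed.

(** * The Hopf algebra given by the presentation *)

Section Descent.
Hypothesis dpi_surj : forall P : A -> Prop, (forall w, P (dpi w)) -> forall x, P x.
Variables (D : {linear A -> T}) (e : {scalar A}) (S : {linear A -> A}).
Hypotheses (DE : forall w, D (dpi w) = free_comul w)
  (eE : forall w, e (dpi w) = feval (daug k (m := m) (n := n)) w)
  (SE : forall w, S (dpi w) = free_antipode w).

Lemma comulM : monoid_morphism D.
Proof.
split; first by rewrite -dpi1 DE free_comul1.
move=> x y; elim/dpi_surj: x => x; elim/dpi_surj: y => y.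
by rewrite -dpiM !DE free_comulM.
Qed.

Lemma antipodeM x y : S (x * y) = S y * S x.
Proof.
by elim/dpi_surj: x => x; elim/dpi_surj: y => y; rewrite -dpiM !SE free_antipodeM.
Qed.

Lemma antipode1 : S 1 = 1.
Proof. by rewrite -{1}dpi1 SE free_antipode1. Qed.

Lemma counitM : monoid_morphism e.
Proof.
split; first by rewrite -dpi1 eE rmorph1.
move=> x y; elim/dpi_surj: x => x; elim/dpi_surj: y => y.
by rewrite -dpiM !eE rmorphM.
Qed.

Lemma comul_gword w : gword w -> D (dpi w) = tens (dpi w) (dpi w).
Proof. by move=> hw; rewrite DE free_comul_gword. Qed.

Lemma counit_gen g : e (dg g) = if is_part g then 0 else 1.
Proof. by rewrite eE feval_gen; case: g. Qed.

Lemma counit_gword w : gword w -> e (dpi w) = 1.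
Proof.
elim=> [|g {}w Gg _ IH]; first by rewrite dpi1 counitM.1.
by rewrite dpiM counitM.2 IH counit_gen (negbTE Gg) mulr1.
Qed.

Lemma comul_dpart i : D (dpart i) = tens (dpart i) (r i) + tens (h i) (dpart i).
Proof. by rewrite DE free_comul_gen. Qed.

Lemma antipode_dpart i : S (dpart i) = - (hV i * dpart i * rV i).
Proof. by rewrite SE free_antipode_gen. Qed.

Lemma antipode_gword u v : gword u -> dpi v * dpi u = 1 -> S (dpi u) = dpi v.
Proof.
move=> hu vu; rewrite SE; have [h1 h2] := free_antipode_gword hu.
by rewrite -[LHS]mul1r -vu -mulrA h2 mulr1.
Qed.

Lemma generator_axioms x : [set x | exists g, x = dg g] x -> hopf_axioms_at D e S x.
Proof.
move=> [g ->]; have [|Gg] := boolP (is_part g); last first.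
  apply: (hopf_axioms_group_like (h := dg (gen_inv g))).
  - by rewrite DE free_comul_gen; case: g Gg.
  - by rewrite counit_gen (negbTE Gg).
  - by rewrite SE free_antipode_gen; case: g Gg.
  - exact: gen_mulV.
  - exact: gen_Vmul.
case: g => // i _; apply: (hopf_axioms_skew (g := r i) (h := h i)).
- exact/comul_gword/gword_rword.
- exact/comul_gword/gword_hword.
- exact/counit_gword/gword_rword.
- exact/counit_gword/gword_hword.
- exact: comul_dpart.
- by rewrite counit_gen.
- rewrite (antipode_gword (gword_hword i) (h_Vmul i)) antipode_dpart.
  by rewrite mulNr -(mulrA _ (rV i)) r_Vmul mulr1 addNr.
- rewrite (antipode_gword (gword_rword i) (r_Vmul i)) antipode_dpart.
  by rewrite mulrN !mulrA h_mulV mul1r subrr.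
Qed.

Definition presented_hopf : hopf A :=
  hopf_of_generators comulM counitM antipode1 antipodeM
    (generators_generate dpi_surj) generator_axioms.

Lemma gword_group_like w : gword w -> group_like presented_hopf (dpi w).
Proof. by move=> hw; split; [exact: comul_gword|exact: counit_gword]. Qed.

Lemma part_skew i : skew_primitive presented_hopf (dpart i).
Proof.
exists (r i), (h i); split; last exact: comul_dpart.
  exact/gword_group_like/gword_rword.
exact/gword_group_like/gword_hword.
Qed.

Lemma comul_dpart_even (i : I) : (i < m)%N ->
  D (dpart i) = tens (dpart i) (dsigV i) + tens (dthetaV i * dsig i) (dpart i).
Proof.
move=> im; have -> : i = lshift n (Ordinal im) by apply: val_inj.
by rewrite comul_dpart /rword /hword split_lshift dpiM.
Qed.

Lemma antipode_dpart_even (i : I) : (i < m)%N -> S (dpart i) = - (q *: (dtheta i * dpart i)).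
Proof.
move=> im; have -> : i = lshift n (Ordinal im) by apply: val_inj.
set j := lshift n _; rewrite antipode_dpart /hwordV /rwordV split_lshift dpiM; congr (- _).
have -> : dsigV j * dtheta j = dtheta j * dsigV j.
  by apply: gword_comm; apply: gword_gen.
have := r_qcomm_self_even (Ordinal im); rewrite /qcomm /rword split_lshift -/j => c.
by rewrite -(mulrA (dtheta j)) c -scalerAr -scalerAl -!mulrA dsigVK mulr1.
Qed.

Lemma comul_dpart_odd (j : 'I_n) (i := rshift m j) :
  D (dpart i) = tens (dpart i) 1 + tens (dthetaV i * dtau j) (dpart i).
Proof. by rewrite comul_dpart /rword /hword split_rshift dpiM dpi1. Qed.

Lemma antipode_dpart_odd (j : 'I_n) (i := rshift m j) :
  S (dpart i) = - (dtheta i * dtau j * dpart i).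
Proof.
rewrite antipode_dpart /hwordV /rwordV split_rshift dpiM dpi1 mulr1; congr (- (_ * _)).
by apply: gword_comm; apply: gword_gen.
Qed.

(** * The restricted ideal is a Hopf ideal *)

Section Restricted.
Variables (N l : nat) (G : set A).
Hypotheses (l_gt0 : (0 < l)%N) (N_gt0 : (0 < N)%N).
Hypotheses (ql : q ^- 2 ^+ l = 1) (qj : forall j, (0 < j < l)%N -> q ^- 2 ^+ j != 1).
Hypotheses (Gsig : forall i, G (dsig i ^+ N - 1)) (Gtheta : forall i, G (dtheta i ^+ N - 1)).
Hypothesis Gpart : forall i : I, (i < m)%N -> G (dpart i ^+ l).
Hypothesis Gonly : forall x, G x ->
  [\/ exists i, x = dsig i ^+ N - 1, exists i, x = dtheta i ^+ N - 1
    | exists2 i : I, (i < m)%N & x = dpart i ^+ l].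

Let J : set T := linspan [set t | exists a b, (ideal G a \/ ideal G b) /\ t = tens a b].

Let J_sub : is_subspace J.
Proof. exact: linspan_subspace. Qed.

Let D_X x a : D (x ^+ a) = D x ^+ a.
Proof.
elim: a => [|a IH]; first by rewrite !expr0 comulM.1.
by rewrite !exprS comulM.2 IH.
Qed.

Let S_X x a : S (x ^+ a) = S x ^+ a.
Proof.
elim: a => [|a IH]; first by rewrite !expr0 antipode1.
by rewrite exprS exprSr antipodeM IH.
Qed.

Let e_X x a : e (x ^+ a) = e x ^+ a.
Proof.
elim: a => [|a IH]; first by rewrite !expr0 counitM.1.
by rewrite !exprS counitM.2 IH.
Qed.

Let tensX (a b : A) c : tens a b ^+ c = tens (a ^+ c) (b ^+ c) :> T.
Proof. by elim: c => [|c IH] //; rewrite !exprS IH tensM. Qed.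

Let J_group g : D g = tens g g -> G (g ^+ N - 1) -> J (D (g ^+ N - 1)).
Proof.
move=> Dg Gg; rewrite linearB D_X Dg tensX comulM.1.
have -> : tens (g ^+ N) (g ^+ N) - 1 =
    tens (g ^+ N - 1) (g ^+ N) + tens 1 (g ^+ N - 1) :> T.
  by rewrite tensBl tensBr addrA subrK.
apply: (subspaceD J_sub); apply: linspan_gen.
  by exists (g ^+ N - 1), (g ^+ N); split=> //; left; apply: ideal_gen.
by exists 1, (g ^+ N - 1); split=> //; right; apply: ideal_gen.
Qed.

Let S_group g g' : S g = g' -> g' * g = 1 -> g * g' = 1 -> G (g ^+ N - 1) ->
  ideal G (S (g ^+ N - 1)).
Proof.
move=> Sg g'g gg' Gg; rewrite linearB S_X Sg antipode1.
have -> : g' ^+ N - 1 = - g' ^+ N * (g ^+ N - 1).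
  rewrite mulNr mulrBr mulr1 -exprMn_comm ?g'g ?expr1n ?opprB //.
  by rewrite /GRing.comm g'g gg'.
by apply: ideal_mull; apply: ideal_gen.
Qed.

(** The two terms of the coproduct of an even partial commute up to q^-2, a
    primitive l-th root of unity, so the l-th power of the sum is the sum of the
    l-th powers. *)
Let J_part (i : 'I_m) (j := lshift n i) : J (D (dpart j ^+ l)).
Proof.
rewrite D_X comul_dpart.
have c1 := r_qcomm_self_even i; have c2 := h_qcomm_self_even i; rewrite -/j in c1 c2.
have c2' := qcomm_sym (invr_neq0 q0) c2; rewrite invrK in c2'.
have yx : tens (h j) (dpart j) * tens (dpart j) (r j) =
    q ^- 2 *: (tens (dpart j) (r j) * tens (h j) (dpart j)).
  rewrite !tensM c2 c1 tensZl tensZr scalerA; congr (_ *: _).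
  by rewrite expr2 invfM mulfVK.
rewrite (qbinomial_root l_gt0 ql qj yx) !tensX.
have Gj : ideal G (dpart j ^+ l) by apply: ideal_gen; apply: Gpart; apply: (ltn_ord i).
apply: (subspaceD J_sub); apply: linspan_gen.
  by exists (dpart j ^+ l), (r j ^+ l); split=> //; left.
by exists (h j ^+ l), (dpart j ^+ l); split=> //; right.
Qed.

Let S_part_ideal (i : 'I_m) (j := lshift n i) : ideal G (S (dpart j ^+ l)).
Proof.
rewrite S_X antipode_dpart_even ?(ltn_ord i) // -scaleNr.
have tp : dpart j * dtheta j = dtheta j * dpart j.
  by have := dtheta_part j j; rewrite thetabii // scale1r.
rewrite exprZn exprMn_comm; last by rewrite /GRing.comm tp.
apply: (subspaceZ _ (linspan_subspace _)); apply: ideal_mull; apply: ideal_gen.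
by apply: Gpart; apply: (ltn_ord i).
Qed.

Lemma restricted_hopf_ideal : hopf_ideal presented_hopf (ideal G).
Proof.
apply: hopf_ideal_of_generators; first exact: antipodeM.
- move=> x /Gonly [[i ->]|[i ->]|[i im ->]].
  + by apply: J_group; [apply: comul_gword; apply: gword_gen|exact: Gsig].
  + by apply: J_group; [apply: comul_gword; apply: gword_gen|exact: Gtheta].
  + have -> : i = lshift n (Ordinal im) by apply: val_inj.
    exact: J_part.
- have e0 : e 1 = 1 by exact: counitM.1.
  move=> x /Gonly [[i ->]|[i ->]|[i im ->]]; rewrite -[LHS]/(e _) ?linearB.
  + by rewrite e_X counit_gword ?e0 ?expr1n ?subrr //; apply: gword_gen.
  + by rewrite e_X counit_gword ?e0 ?expr1n ?subrr //; apply: gword_gen.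
  + by rewrite e_X counit_gen /= expr0n; case: l l_gt0.
- move=> x /Gonly [[i ->]|[i ->]|[i im ->]].
  + apply: (S_group (g' := dsigV i)) => //; [|exact: dsigVK|exact: dsigK].
    by apply: antipode_gword; [apply: gword_gen|exact: dsigVK].
  + apply: (S_group (g' := dthetaV i)) => //; [|exact: dthetaVK|exact: dthetaK].
    by apply: antipode_gword; [apply: gword_gen|exact: dthetaVK].
  + have -> : i = lshift n (Ordinal im) by apply: val_inj.
    exact: S_part_ideal.
Qed.

End Restricted.
End Descent.

(** * Finite dimension and commutation up to theta *)

Section Truncated.
Variables (N l : nat).
Hypotheses (l_gt0 : (0 < l)%N) (N_gt0 : (0 < N)%N).
Hypotheses (sigN : forall i, dsig i ^+ N = 1) (thetaN1 : forall i, dtheta i ^+ N = 1).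
Hypothesis partl : forall i : I, (i < m)%N -> dpart i ^+ l = 0.
Hypothesis dpi_surj : forall P : A -> Prop, (forall w, P (dpi w)) -> forall x, P x.

(** In the truncated algebra the remaining generators are powers of these. *)
Definition positive_gen (g : dgen m n) : bool :=
  match g with GThetaV _ | GSigmaV _ => false | _ => true end.

Lemma positive_gens_qcomm g g' : positive_gen g -> positive_gen g' ->
  exists c, dg g * dg g' = c *: (dg g' * dg g).
Proof.
have group u u' : ~~ is_part u -> ~~ is_part u' ->
    exists c, dg u * dg u' = c *: (dg u' * dg u).
  by move=> Gu Gu'; exists 1; rewrite scale1r gen_comm.
have mixed u i : positive_gen u -> ~~ is_part u ->
    exists2 c, c != 0 & qcomm c (dg u) (dpart i).
  case: u => // j _ _.
  - by exists (thetab q i j); [exact: thetab_neq0|exact: dtheta_part].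
  - by exists (sigchar i j); [exact: sigchar_neq0|exact: dsig_part].
  - exists ((-1) ^+ (i == rshift m j)); first by rewrite signr_eq0.
    exact: dtau_part.
move=> pg pg'; have [|Gg] := boolP (is_part g); have [|Gg'] := boolP (is_part g').
- by case: g' {pg'} => // j _; case: g {pg} => // i _; exists (thetab q i j); apply: dpartC.
- case: g {pg} => // i _; have [c c0 e] := mixed g' i pg' Gg'.
  by exists c^-1; apply: (qcomm_sym c0 e).
- by case: g' {pg'} => // i _; have [c _ e] := mixed g i pg Gg; exists c.
- exact: group.
Qed.

Lemma positive_gen_bounded g : positive_gen g ->
  exists2 a, (0 < a)%N & dg g ^+ a = 0 \/ dg g ^+ a = 1.
Proof.
case: g => // i _.
- case: (split_ordP i) => j e.
    by exists l => //; left; apply: partl; rewrite e /= ltn_ord.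
  by exists 2%N => //; left; rewrite e; apply: dpart_sq.
- by exists N => //; right; apply: thetaN1.
- by exists N => //; right; apply: sigN.
- by exists 2%N => //; right; rewrite expr2; apply: dtauK.
Qed.

Lemma truncated_finite_span : exists s : seq A, forall v, linspan [set x | x \in s] v.
Proof.
pose xs := [seq dg g | g <- [seq GPartial i | i : I] ++ [seq GTheta i | i : I] ++
  [seq GSigma i | i : I] ++ [seq GTau m j | j : 'I_n]].
have xsP (x : A) : x \in xs <-> exists2 g, positive_gen g & x = dg g.
  split=> [/mapP [g hg ->]|[g pg ->]].
    by exists g => //; move: hg; rewrite !mem_cat => /or4P[] /mapP [i _ ->].
  apply/mapP; exists g => //; rewrite !mem_cat; case: g pg => // i _; apply/or4P.
  - by apply: Or41; apply: map_f; rewrite mem_enum.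
  - by apply: Or42; apply: map_f; rewrite mem_enum.
  - by apply: Or43; apply: map_f; rewrite mem_enum.
  - by apply: Or44; apply: map_f; rewrite mem_enum.
apply: (qcommuting_finite_span (xs := xs) (generators_generate dpi_surj)).
- by move=> _ _ /xsP [g pg ->] /xsP [g' pg' ->]; apply: positive_gens_qcomm.
- by move=> _ /xsP [g pg ->]; apply: positive_gen_bounded.
have inverse (x x' : A) : x ^+ N = 1 -> x' * x = 1 -> x' = x ^+ N.-1.
  by move=> xN x'x; rewrite -[LHS]mulr1 -xN -(prednK N_gt0) exprS mulrA x'x mul1r.
move=> _ [g ->]; have [pg|] := boolP (positive_gen g).
  by exists (dg g), 1%N; rewrite expr1; split=> //; apply/xsP; exists g.
case: g => // i _.
- exists (dtheta i), N.-1; split; first by apply/xsP; exists (GTheta i).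
  exact: (inverse (dtheta i) (dthetaV i) (thetaN1 i) (dthetaVK i)).
- exists (dsig i), N.-1; split; first by apply/xsP; exists (GSigma i).
  exact: (inverse (dsig i) (dsigV i) (sigN i) (dsigVK i)).
Qed.

End Truncated.

Lemma lift_tuple_nat N (x : zgrpN m n N) i :
  zgrp_tuple (lift_zgrp x) 0 i = `|zgrp_tuple (lift_zgrp x) 0%R i|%N%:Z.
Proof.
by rewrite gez0_abs // mxE; case: split => j; rewrite mxE.
Qed.

Lemma presented_theta_associated N :
  theta_associated q N (fun i => dpart i) (fun i => dtheta i).
Proof.
move=> x y; rewrite /zmonomial /thetaN theta_prod //.
set a := fun i => `|zgrp_tuple (lift_zgrp x) 0%R i|%N.
set b := fun i => `|zgrp_tuple (lift_zgrp y) 0%R i|%N.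
have -> : \prod_(i < m + n) \prod_(j < m + n) thetab q i j ^
      (zgrp_tuple (lift_zgrp x) 0 i * zgrp_tuple (lift_zgrp y) 0 j) =
    \prod_(i < m + n) \prod_(j < m + n) thetab q i j ^+ (a i * b j).
  apply: eq_bigr => i _; apply: eq_bigr => j _.
  by rewrite lift_tuple_nat (lift_tuple_nat y) -PoszM.
split.
  apply: qcomm_prod => i j; exact: dtheta_part.
have -> : \prod_(i < m + n) \prod_(j < m + n) thetab q i j ^+ (a i * b j) =
    \prod_(j < m + n) \prod_(i < m + n) thetab q i j ^+ (b j * a i).
  rewrite exchange_big; apply: eq_bigr => j _; apply: eq_bigr => i _.
  by rewrite mulnC.
by apply: qcomm_prod => i j; apply: dpartC.
Qed.


End Presentation.

(** * The restricted quantum differential Hopf algebra *)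

(** Since l >= 3, the quantum integer 1 is nonzero, which excludes q = -1; then
    the quantum integer j vanishes exactly when q^(2j) = 1, so q^-2 is a primitive
    l-th root of unity. *)
Lemma qchar_root (k : fieldType) (q : k) (l : nat) : q != 0 -> (3 <= l)%N ->
  is_qchar q l ->
  [/\ q ^+ l.*2 = 1, q ^- 2 ^+ l = 1 & forall j, (0 < j < l)%N -> q ^- 2 ^+ j != 1].
Proof.
move=> q0 l3; rewrite /is_qchar; case: eqP => [l0|_ [ql qj]]; first by rewrite l0 in l3.
have l1 : (0 < 1 < l)%N by apply: leq_trans l3.
have d0 : q - q^-1 != 0.
  by apply/eqP => d; apply: (qj 1%N l1); rewrite /qint expr1 d mul0r.
have eqE j : qint q j = 0 <-> q ^+ j.*2 = 1.
  rewrite /qint -addnn exprD; split=> [/eqP|h].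
    rewrite mulf_eq0 invr_eq0 (negbTE d0) orbF subr_eq0 => /eqP e.
    by rewrite {1}e mulVf // expf_neq0.
  by rewrite -[X in X - _](mulfK (expf_neq0 j q0)) h div1r subrr mul0r.
have VE j : q ^- 2 ^+ j = (q ^+ j.*2)^-1 by rewrite exprVn -exprM mul2n.
have q2l := (eqE l).1 ql; split=> //; first by rewrite VE q2l invr1.
move=> j /qj qj0; rewrite VE; apply/eqP => /(congr1 (@GRing.inv k)).
by rewrite invrK invr1 => /eqE.
Qed.

Section Main.
Variables (k : fieldType) (q : k) (m n l : nat).
Hypotheses (q0 : q != 0) (l3 : (3 <= l)%N) (hq : is_qchar q l).
Local Notation F := (freealg k (dgen m n)).
Local Notation A := (Dq q m n).
Local Notation Q := (Dq1 q m n l3).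
Local Notation N := (tord l).

Let piA : {lrmorphism F -> A} := @dpi k q m n.
Let piQ : {lrmorphism F -> Q} := @rpi k q m n l l3 \o @dpi k q m n.

Let N_gt1 : (1 < N)%N.
Proof. by rewrite /tord; case: ifP => _; lia. Qed.

Let l_gt0 : (0 < l)%N.
Proof. exact: ltnW (ltnW l3). Qed.

Lemma dpi_rel u v : drel q u v -> piA u = piA v.
Proof. by move=> uv; apply/apiP; apply: ideal_gen; exists u, v. Qed.

Lemma dpi_surj (P : A -> Prop) : (forall w, P (piA w)) -> forall x, P x.
Proof. exact: api_ind. Qed.

Let D := aquot_lift (@drel_proper k q m n) (free_comul_ideal q0 dpi_rel).
Let S := aquot_lift (@drel_proper k q m n) (free_antipode_ideal q0 dpi_rel).
Let e : {scalar A} := scalar_of (f := @Dq_aug k q m n)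
  (fun c u v => etrans (raddfD _ _ _) (congr1 (fun x => x + _) (Dq_augZ c u))).

Let DE w : D (piA w) = free_comul piA w.
Proof. exact: (aquot_liftE _ (free_comul_ideal q0 dpi_rel)). Qed.

Let SE w : S (piA w) = free_antipode piA w.
Proof. exact: (aquot_liftE _ (free_antipode_ideal q0 dpi_rel)). Qed.

Let eE w : e (piA w) = feval (daug k (m := m) (n := n)) w.
Proof. exact: dpi_aug. Qed.

Definition Dq_hopf : hopf A := presented_hopf dpi_rel dpi_surj DE eE SE.

Lemma Dq_hopfP : Dq_hopf_spec Dq_hopf.
Proof.
have G := gword_group_like dpi_rel dpi_surj DE eE SE.
split.
- by move=> i; split; apply: G; apply: gword_gen.
- by move=> j; apply: G; apply: gword_gen.
- move=> i im; split; first exact: (comul_dpart_even DE).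
  exact: (antipode_dpart_even q0 dpi_rel SE).
- move=> j i; split; first exact: (comul_dpart_odd DE).
  exact: (antipode_dpart_odd dpi_rel SE).
- by move=> i; exact: (counit_gen eE (GPartial i)).
Qed.

Lemma restr_hopf_ideal : hopf_ideal Dq_hopf (@restr_ideal k q m n l).
Proof.
have [_ ql qj] := qchar_root q0 l3 hq.
apply: (restricted_hopf_ideal q0 dpi_rel dpi_surj DE eE SE (N := N) l_gt0 ql qj).
- exact: RSig.
- exact: RTheta.
- exact: RPart.
- move=> x [i|i|i im]; [apply: Or31|apply: Or32|apply: Or33]; by exists i.
Qed.

Definition Dq1_hopf : hopf Q := quotient_hopf (restr_proper l3) restr_hopf_ideal.

Lemma rpi_hopf_morphism : hopf_morphism Dq_hopf Dq1_hopf (@rpi k q m n l l3).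
Proof. exact: api_hopf_morphism. Qed.

Lemma rpi_dpi_rel u v : drel q u v -> piQ u = piQ v.
Proof. by move=> /dpi_rel h; rewrite /= [dpi _ _]h. Qed.

Lemma Dq1_finite_span : exists s : seq Q, forall v, linspan [set x | x \in s] v.
Proof.
have r0 x : restr_gens l x -> @rpi k q m n l l3 x = 0.
  by move=> hx; apply: ideal_api0; apply: ideal_gen.
apply: (truncated_finite_span q0 rpi_dpi_rel l_gt0 (ltnW N_gt1)).
- move=> i; apply/eqP; rewrite -subr_eq0; apply/eqP.
  by have := r0 _ (RSig q l i); rewrite rmorphB rmorphXn rmorph1.
- move=> i; apply/eqP; rewrite -subr_eq0; apply/eqP.
  by have := r0 _ (RTheta q l i); rewrite rmorphB rmorphXn rmorph1.
- by move=> i im; have := r0 _ (RPart q l im); rewrite rmorphXn.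
- by move=> P hP; apply: api_ind => x; move: x; apply: dpi_surj.
Qed.

Lemma Dq1_findim : findim Q.
Proof. by have [s sQ] := Dq1_finite_span; apply: finite_span_iso sQ. Qed.

Lemma Dq1_pointed : pointed Dq1_hopf.
Proof.
have [s sQ] := Dq1_finite_span; apply: (pointed_of_skew_generated sQ).
move=> P hP P1 Pg.
apply: (generates_quot (generators_generate dpi_surj) hP P1) => _ x [_ [g ->] ->].
apply: Pg.
have [pg|Gg] := boolP (is_part g); [right|left].
  apply: (morphism_skew_primitive rpi_hopf_morphism).
  by case: g pg => // i _; apply: part_skew.
apply: (morphism_group_like rpi_hopf_morphism).
by apply: gword_group_like; apply: gword_gen.
Qed.

Lemma Dq1_theta_associated : theta_associated q N
  (fun i : 'I_(m + n) => @rpi k q m n l l3 (dpart q i))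
  (fun i : 'I_(m + n) => @rpi k q m n l l3 (dtheta q i)).
Proof. exact: (presented_theta_associated q0 rpi_dpi_rel). Qed.

Lemma theta_well_defined : (odd l -> q ^+ l = 1) -> forall x y : zgrp m n,
  thetaN q (red_zgrp N x) (red_zgrp N y) = theta q x y.
Proof.
have [q2l _ _] := qchar_root q0 l3 hq.
move=> ol x y; apply: theta_reduction => //.
by rewrite /tord; case: ifP.
Qed.

End Main.

Theorem corollary12 (k : closedFieldType) (k_char0 : [pchar k] =i pred0)
    (q : k) (q_neq0 : q != 0) (q_neq1 : q != 1) (m n l : nat)
    (l_ge3 : (3 <= l)%N) (q_char : is_qchar q l) :
  exists HD : hopf (Dq q m n),
    [/\ Dq_hopf_spec HD,
        hopf_ideal HD (@restr_ideal k q m n l)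
      & exists HQ : hopf (Dq1 q m n l_ge3),
        [/\ hopf_morphism HD HQ (@rpi k q m n l l_ge3),
            findim (Dq1 q m n l_ge3),
            pointed HQ,
            theta_associated q (tord l)
              (fun i : 'I_(m + n) => @rpi k q m n l l_ge3 (dpart q i))
              (fun i : 'I_(m + n) => @rpi k q m n l l_ge3 (dtheta q i))
          & (odd l -> q ^+ l = 1) ->
            forall x y : zgrp m n,
              thetaN q (red_zgrp (tord l) x) (red_zgrp (tord l) y) =
              theta q x y]].
Proof.
exists (Dq_hopf m n q_neq0); split; first exact: Dq_hopfP.
  exact: restr_hopf_ideal.
exists (Dq1_hopf m n q_neq0 l_ge3 q_char); split.
- exact: rpi_hopf_morphism.
- exact: Dq1_findim.
- exact: Dq1_pointed.
- exact: Dq1_theta_associated.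
- exact: theta_well_defined.
Qed.
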